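(* Let $\zeta$ be the $\mathbb P_0$-almost sure limit of $-\frac1t\log L_t(\mathcal X^t)$ (the Neyman–Pearson error exponent for the probability of miss). Then $\underline\zeta\le\zeta$, where $\underline\zeta$ is the optimal value (infimum) of $$\begin{array}{ll}\text{minimize over }(\theta,\xi) & D(\theta\|P)+\sum_{i:\overline\theta_i>0}\overline\theta_i\frac{(\beta_i-\xi_i/\overline\theta_i)^2}{2}\\ \text{subject to}& H(\theta)\ge J_\theta(\xi),\quad\theta\in\Delta,\quad\xi\in\mathbb R^N.\end{array}$$
   Context: $V=\{1,\dots,N\}$; $P$ row-stochastic, irreducible, aperiodic, with stationary distribution $\pi>0$; $E=\{(i,j):P_{ij}>0\}$; $\beta_1,\dots,\beta_N\in\mathbb R$. $P(s^t)=\pi_{s_1}\prod_{k=1}^{t-1}P_{s_ks_{k+1}}$, $\mathcal S^t=\{s^t\in V^t:P(s^t)>0\}$. Under $\mathcal H_0$ (law $\mathbb P_0$) the $X_{i,k}$ ($i\in V,k\ge1$) are i.i.d. $\mathcal N(0,1)$; under $\mathcal H_1$ a Markov chain $(S_k)$ with initial law $\pi$ and transition matrix $P$ is present and conditionally on it $X_{i,k}\sim\mathcal N(\beta_i,1)$ if $S_k=i$, $\mathcal N(0,1)$ otherwise, independently. $L_t(\mathcal X^t)=\sum_{s^t\in\mathcal S^t}P(s^t)\exp\big(\sum_{k=1}^t(\beta_{s_k}X_{s_k,k}-\beta_{s_k}^2/2)\big)$. $\Delta=\{\theta\in\mathbb R^{N\times N}:\theta_{ij}\ge0,\sum_{i,j}\theta_{ij}=1,\sum_j\theta_{ij}=\sum_j\theta_{ji}\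 \forall i,\ \theta_{ij}=0\text{ if }(i,j)\notin E\}$, $\overline\theta=\theta\mathbf1$. $H(\theta)=-\sum_{i,j}\theta_{ij}\log\frac{\theta_{ij}}{\overline\theta_i}$, $D(\theta\|P)=\sum_{i,j}\theta_{ij}\log\frac{\theta_{ij}}{\overline\theta_iP_{ij}}$ (terms with $\theta_{ij}=0$ are $0$). $J_\theta(\xi)=\sum_{i:\overline\theta_i>0}\frac{1}{\overline\theta_i}\frac{\xi_i^2}{2}$ if $\xi_i=0$ whenever $\overline\theta_i=0$, and $+\infty$ otherwise. *)

(* Defs.v *)
From Stdlib Require Export Reals Lra List ClassicalEpsilon.
Export ListNotations.
Open Scope R_scope.

(* States are 0..N-1 (paper's 1..N shifted), times are k >= 1. *)

Fixpoint rsum (n : nat) (f : nat -> R) : R :=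
  match n with O => 0 | S m => rsum m f + f m end.

Fixpoint mpow (N : nat) (P : nat -> nat -> R) (n : nat) (i j : nat) : R :=
  match n with
  | O => if Nat.eq_dec i j then 1 else 0
  | S m => rsum N (fun l => mpow N P m i l * P l j)
  end.

Definition row_stochastic (N : nat) (P : nat -> nat -> R) : Prop :=
  (forall i j, (i < N)%nat -> (j < N)%nat -> 0 <= P i j) /\
  (forall i, (i < N)%nat -> rsum N (fun j => P i j) = 1).

Definition irreducible (N : nat) (P : nat -> nat -> R) : Prop :=
  forall i j, (i < N)%nat -> (j < N)%nat -> exists n, 0 < mpow N P n i j.

Definition aperiodic (N : nat) (P : nat -> nat -> R) : Prop :=
  forall i, (i < N)%nat ->
    forall d : nat,
      (forall n, (1 <= n)%nat -> 0 < mpow N P n i i -> Nat.divide d n) -> d = 1%nat.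

Definition stationary (N : nat) (P : nat -> nat -> R) (pi : nat -> R) : Prop :=
  (forall i, (i < N)%nat -> 0 < pi i) /\
  rsum N pi = 1 /\
  (forall j, (j < N)%nat -> rsum N (fun i => pi i * P i j) = pi j).

Fixpoint paths (N t : nat) : list (list nat) :=
  match t with
  | O => [ [] ]
  | S t' => flat_map (fun s => map (fun i => s ++ [i]) (seq 0 N)) (paths N t')
  end.

Fixpoint chain_prob (P : nat -> nat -> R) (a : nat) (rest : list nat) : R :=
  match rest with
  | [] => 1
  | b :: r => P a b * chain_prob P b r
  end.

Definition path_prob (pi : nat -> R) (P : nat -> nat -> R) (s : list nat) : R :=
  match s with
  | [] => 1
  | a :: r => pi a * chain_prob P a r
  end.

Fixpoint path_exponent (beta : nat -> R) (x : nat -> nat -> R) (s : list nat) (k : nat) : R :=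
  match s with
  | [] => 0
  | a :: r => (beta a * x a k - beta a ^ 2 / 2) + path_exponent beta x r (S k)
  end.

Definition Lt (N : nat) (pi : nat -> R) (P : nat -> nat -> R) (beta : nat -> R)
  (t : nat) (x : nat -> nat -> R) : R :=
  fold_right Rplus 0
    (map (fun s => if Rlt_dec 0 (path_prob pi P s)
                   then path_prob pi P s * exp (path_exponent beta x s 1)
                   else 0)
         (paths N t)).

Definition std_normal_cdf (Phi : R -> R) : Prop :=
  (forall x, derivable_pt_lim Phi x (exp (- (x ^ 2) / 2) / sqrt (2 * PI))) /\
  (forall eps, 0 < eps -> exists M, forall x, x <= M -> Rabs (Phi x) < eps).

Definition prob_space (Omega : Type) (F : (Omega -> Prop) -> Prop)
  (Pr : (Omega -> Prop) -> R) : Prop :=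
  F (fun _ => True) /\
  (forall A, F A -> F (fun w => ~ A w)) /\
  (forall A : nat -> Omega -> Prop, (forall n, F (A n)) -> F (fun w => exists n, A n w)) /\
  (forall A, F A -> 0 <= Pr A) /\
  Pr (fun _ => True) = 1 /\
  (forall A : nat -> Omega -> Prop, (forall n, F (A n)) ->
     (forall n m w, n <> m -> A n w -> A m w -> False) ->
     infinite_sum (fun n => Pr (A n)) (Pr (fun w => exists n, A n w))).

(** Under H0: the X_{i,k} (i in V, k >= 1) are i.i.d. N(0,1) random variables:
    measurable, and for every finite family of distinct indices the joint
    CDF factorizes into standard normal CDFs. *)
Definition iid_std_gaussian (N : nat) (Omega : Type) (F : (Omega -> Prop) -> Prop)
  (Pr : (Omega -> Prop) -> R) (Phi : R -> R) (X : nat -> nat -> Omega -> R) : Prop :=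
  (forall i k a, (i < N)%nat -> (1 <= k)%nat -> F (fun w => X i k w <= a)) /\
  (forall l : list ((nat * nat) * R),
     NoDup (map fst l) ->
     Forall (fun p => (fst (fst p) < N)%nat /\ (1 <= snd (fst p))%nat) l ->
     Pr (fun w => Forall (fun p => X (fst (fst p)) (snd (fst p)) w <= snd p) l)
     = fold_right Rmult 1 (map (fun p => Phi (snd p)) l)).

Definition theta_bar (N : nat) (theta : nat -> nat -> R) (i : nat) : R :=
  rsum N (fun j => theta i j).

Definition in_Delta (N : nat) (P : nat -> nat -> R) (theta : nat -> nat -> R) : Prop :=
  (forall i j, (i < N)%nat -> (j < N)%nat -> 0 <= theta i j) /\
  rsum N (fun i => rsum N (fun j => theta i j)) = 1 /\
  (forall i, (i < N)%nat -> rsum N (fun j => theta i j) = rsum N (fun j => theta j i)) /\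
  (forall i j, (i < N)%nat -> (j < N)%nat -> ~ (0 < P i j) -> theta i j = 0).

Definition entropy (N : nat) (theta : nat -> nat -> R) : R :=
  - rsum N (fun i => rsum N (fun j =>
      if Req_EM_T (theta i j) 0 then 0
      else theta i j * ln (theta i j / theta_bar N theta i))).

Definition rel_entropy (N : nat) (theta P : nat -> nat -> R) : R :=
  rsum N (fun i => rsum N (fun j =>
      if Req_EM_T (theta i j) 0 then 0
      else theta i j * ln (theta i j / (theta_bar N theta i * P i j)))).

(** J_theta(xi); None stands for +infinity *)
Definition J_theta (N : nat) (theta : nat -> nat -> R) (xi : nat -> R) : option R :=
  if excluded_middle_informative
       (forall i, (i < N)%nat -> theta_bar N theta i = 0 -> xi i = 0)
  then Some (rsum N (fun i =>
          if Rlt_dec 0 (theta_bar N theta i)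
          then / theta_bar N theta i * (xi i ^ 2 / 2) else 0))
  else None.

Definition H_ge_J (N : nat) (theta : nat -> nat -> R) (xi : nat -> R) : Prop :=
  match J_theta N theta xi with
  | Some v => v <= entropy N theta
  | None => False
  end.

Definition objective (N : nat) (P : nat -> nat -> R) (beta : nat -> R)
  (theta : nat -> nat -> R) (xi : nat -> R) : R :=
  rel_entropy N theta P +
  rsum N (fun i =>
    if Rlt_dec 0 (theta_bar N theta i)
    then theta_bar N theta i * ((beta i - xi i / theta_bar N theta i) ^ 2 / 2)
    else 0).

Definition feasible (N : nat) (P : nat -> nat -> R) (theta : nat -> nat -> R)
  (xi : nat -> R) : Prop :=
  H_ge_J N theta xi /\ in_Delta N P theta.

(* Main.v *)
(* For 0 < s <= 1, subadditivity of x^s bounds E_0[L_T^s] by the sum over paths of the products of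
   M_s(i,j) = P_ij^s exp ((s^2 - s) beta_i^2 / 2), hence by a constant times Z = tr M_s^t with
   t - T bounded; Markov's inequality and Borel-Cantelli give zeta >= - (ln Z) / (s t) up to o(1).
   Conversely let theta be the pair frequencies of a random closed walk of length t with weights
   M_s, and xi_i = s beta_i theta_bar_i. Then theta is in Delta, and the Gibbs variational
   principle, ln Z <= ln N + t (H(theta) + sum theta ln M_s), shows that the objective at
   (theta, xi) is at most (ln N - ln Z) / (s t) + (1 - s) / s * (H(theta) - J_theta(xi)).
   By the intermediate value theorem s can be chosen, bounded away from 0 uniformly in t, with
   H >= J and (1 - s) (H - J) = 0.
   Gaussian moments are obtained without integration: on a grid of mesh h, the increments of Phi
   weighted by exp (c x) are dominated by those of exp (c^2/2) Phi (x - c), which telescope. *)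
Require Import Defs.
From Stdlib Require Import Reals List ClassicalEpsilon.
From Stdlib Require Import Lra Lia Arith PropExtensionality FunctionalExtensionality Permutation.
Open Scope R_scope.

(** * Powers of nonnegative matrices *)

(** The matrices [M_s] come from Lagrangian duality. With a multiplier [lambda] for the constraint
    [H >= J], minimizing over [xi] gives [xi_i = beta_i theta_bar_i / (1 + lambda)]; put
    [s = 1 / (1 + lambda)]. What is left to minimize over [theta] is [- 1 / s] times
    [H(theta) + sum theta ln M_s], the Gibbs functional of the very matrix that bounds the moment of
    order [s]. Hence the two sides meet without a minimax theorem, and [(1 - s) (H - J) = 0] is
    complementary slackness. Closed walks of finite length take the place of Perron eigenvectors:
    their pair frequencies are exactly balanced and visibly continuous in [s]. The price is the
    error [ln N / (s t)], which explodes as [s] tends to 0, so [s] needs a lower bound that does not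
    depend on [t]. It comes from [s = 0], where [M_s] is the 0/1 adjacency matrix of the edge set:
    with at least two states its closed walks are exponentially numerous, so for small [s] the
    entropy stays away from 0 while [J] is of order [s^2]. *)

Lemma rsum_ext n f g : (forall i, (i < n)%nat -> f i = g i) -> rsum n f = rsum n g.
Proof.
  induction n; simpl; intros H; auto.
  rewrite IHn by (intros; apply H; lia). rewrite H by lia. reflexivity.
Qed.

Lemma rsum_le n f g : (forall i, (i < n)%nat -> f i <= g i) -> rsum n f <= rsum n g.
Proof.
  induction n; simpl; intros H; [lra|].
  apply Rplus_le_compat; [apply IHn; intros; apply H; lia | apply H; lia].
Qed.

Lemma rsum_const n c : rsum n (fun _ => c) = INR n * c.
Proof. induction n; [simpl; ring|]. rewrite S_INR. simpl. rewrite IHn. ring. Qed.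

Lemma rsum_0 n f : (forall i, (i < n)%nat -> f i = 0) -> rsum n f = 0.
Proof. intros H. rewrite (rsum_ext n f (fun _ => 0)) by auto. rewrite rsum_const. ring. Qed.

Lemma rsum_nonneg n f : (forall i, (i < n)%nat -> 0 <= f i) -> 0 <= rsum n f.
Proof.
  intros H. replace 0 with (rsum n (fun _ => 0)) by (apply rsum_0; auto). apply rsum_le; auto.
Qed.

Lemma rsum_plus n f g : rsum n (fun i => f i + g i) = rsum n f + rsum n g.
Proof. induction n; simpl; [ring|]. rewrite IHn. ring. Qed.

Lemma rsum_scal_l n c f : rsum n (fun i => c * f i) = c * rsum n f.
Proof. induction n; simpl; [ring|]. rewrite IHn. ring. Qed.

Lemma rsum_scal_r n c f : rsum n (fun i => f i * c) = rsum n f * c.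
Proof. induction n; simpl; [ring|]. rewrite IHn. ring. Qed.

Lemma rsum_swap n m (f : nat -> nat -> R) :
  rsum n (fun i => rsum m (fun j => f i j)) = rsum m (fun j => rsum n (fun i => f i j)).
Proof.
  induction n; simpl.
  - symmetry. apply rsum_0. auto.
  - rewrite IHn, <- rsum_plus. reflexivity.
Qed.

Lemma rsum_ge_term n f k :
  (forall i, (i < n)%nat -> 0 <= f i) -> (k < n)%nat -> f k <= rsum n f.
Proof.
  induction n; simpl; intros H Hk; [lia|].
  assert (0 <= f n) by (apply H; lia).
  destruct (Nat.eq_dec k n) as [->|].
  - assert (0 <= rsum n f) by (apply rsum_nonneg; intros; apply H; lia). lra.
  - assert (f k <= rsum n f) by (apply IHn; [intros; apply H|]; lia). lra.
Qed.

Lemma rsum_pos n f k :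
  (forall i, (i < n)%nat -> 0 <= f i) -> (k < n)%nat -> 0 < f k -> 0 < rsum n f.
Proof. intros H Hk Hf. pose proof (rsum_ge_term n f k H Hk). lra. Qed.

Lemma rsum_pos_inv n f :
  0 < rsum n f -> exists k, (k < n)%nat /\ 0 < f k.
Proof.
  induction n; simpl; intros H; [lra|].
  destruct (Rlt_dec 0 (f n)) as [h|h]; [exists n; auto|].
  destruct IHn as [k [Hk Hf]]; [lra|]. exists k; split; auto.
Qed.

Lemma rsum_nonneg_eq0 n f k :
  (forall i, (i < n)%nat -> 0 <= f i) -> rsum n f = 0 -> (k < n)%nat -> f k = 0.
Proof. intros H H0 Hk. pose proof (rsum_ge_term n f k H Hk). pose proof (H k Hk). lra. Qed.

Lemma rsum_delta n i f :
  (i < n)%nat -> rsum n (fun l => (if Nat.eq_dec i l then 1 else 0) * f l) = f i.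
Proof.
  induction n; simpl; intros Hi; [lia|].
  destruct (Nat.eq_dec i n) as [->|].
  - rewrite rsum_0; [ring|]. intros l Hl. destruct (Nat.eq_dec n l); [lia|ring].
  - rewrite IHn by lia. ring.
Qed.

Lemma rsum2_ext n (f g : nat -> nat -> R) :
  (forall i j, (i < n)%nat -> (j < n)%nat -> f i j = g i j) ->
  rsum n (fun i => rsum n (fun j => f i j)) = rsum n (fun i => rsum n (fun j => g i j)).
Proof. intros H. apply rsum_ext; intros. apply rsum_ext; auto. Qed.

Lemma rsum2_scal_l n c (f : nat -> nat -> R) :
  rsum n (fun i => rsum n (fun j => c * f i j)) = c * rsum n (fun i => rsum n (fun j => f i j)).
Proof. rewrite <- rsum_scal_l. apply rsum_ext; intros. apply rsum_scal_l. Qed.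

Lemma rsum2_plus n (f g : nat -> nat -> R) :
  rsum n (fun i => rsum n (fun j => f i j + g i j)) =
  rsum n (fun i => rsum n (fun j => f i j)) + rsum n (fun i => rsum n (fun j => g i j)).
Proof. rewrite <- rsum_plus. apply rsum_ext; intros. apply rsum_plus. Qed.

Definition nonneg_mx (N : nat) (M : nat -> nat -> R) : Prop :=
  forall i j, (i < N)%nat -> (j < N)%nat -> 0 <= M i j.

Lemma mpow_nonneg N M n : nonneg_mx N M -> nonneg_mx N (mpow N M n).
Proof.
  intros HM. induction n; intros i j Hi Hj; simpl.
  - destruct (Nat.eq_dec i j); lra.
  - apply rsum_nonneg; intros. apply Rmult_le_pos; auto.
Qed.

Lemma mpow_add N M a b i j : (i < N)%nat -> (j < N)%nat ->
  mpow N M (a + b) i j = rsum N (fun l => mpow N M a i l * mpow N M b l j).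
Proof.
  intros Hi. revert j. induction b; intros j Hj.
  - rewrite Nat.add_0_r. simpl.
    rewrite (rsum_ext N _ (fun l => (if Nat.eq_dec j l then 1 else 0) * mpow N M a i l)).
    + symmetry. apply (rsum_delta N j (fun l => mpow N M a i l)). auto.
    + intros l Hl. destruct (Nat.eq_dec l j), (Nat.eq_dec j l); subst; try congruence; ring.
  - rewrite Nat.add_succ_r. simpl.
    rewrite (rsum_ext N _ (fun l => rsum N (fun k => mpow N M a i k * mpow N M b k l * M l j))).
    + rewrite rsum_swap. apply rsum_ext; intros k Hk.
      rewrite <- rsum_scal_l. apply rsum_ext; intros; ring.
    + intros l Hl. rewrite IHb by auto. rewrite <- rsum_scal_r. reflexivity.
Qed.

Lemma mpow_1 N M i j : (i < N)%nat -> mpow N M 1 i j = M i j.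
Proof. intros Hi. simpl. apply (rsum_delta N i (fun l => M l j)). auto. Qed.

Lemma mpow_S_l N M n i j : (i < N)%nat -> (j < N)%nat ->
  mpow N M (S n) i j = rsum N (fun l => M i l * mpow N M n l j).
Proof.
  intros Hi Hj. replace (S n) with (1 + n)%nat by lia. rewrite mpow_add by auto.
  apply rsum_ext; intros. rewrite mpow_1; auto.
Qed.

Lemma mpow_add_ge N M a b i l j : nonneg_mx N M ->
  (i < N)%nat -> (j < N)%nat -> (l < N)%nat ->
  mpow N M a i l * mpow N M b l j <= mpow N M (a + b) i j.
Proof.
  intros HM Hi Hj Hl. rewrite mpow_add by auto.
  apply (rsum_ge_term N (fun l => mpow N M a i l * mpow N M b l j)); auto.
  intros. apply Rmult_le_pos; apply mpow_nonneg; auto.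
Qed.

Lemma mpow_pos_add N M a b i l j : nonneg_mx N M ->
  (i < N)%nat -> (j < N)%nat -> (l < N)%nat ->
  0 < mpow N M a i l -> 0 < mpow N M b l j -> 0 < mpow N M (a + b) i j.
Proof.
  intros HM Hi Hj Hl Ha Hb. pose proof (mpow_add_ge N M a b i l j HM Hi Hj Hl).
  pose proof (Rmult_lt_0_compat _ _ Ha Hb). lra.
Qed.

Lemma mpow_scal_le N A B c n : 0 <= c -> nonneg_mx N A ->
  (forall i j, (i < N)%nat -> (j < N)%nat -> c * A i j <= B i j) ->
  forall i j, (i < N)%nat -> (j < N)%nat -> c ^ n * mpow N A n i j <= mpow N B n i j.
Proof.
  intros Hc HA HAB. induction n; intros i j Hi Hj; simpl; [lra|].
  rewrite <- rsum_scal_l. apply rsum_le; intros l Hl.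
  replace (c * c ^ n * (mpow N A n i l * A l j)) with ((c ^ n * mpow N A n i l) * (c * A l j)) by ring.
  apply Rmult_le_compat; auto.
  - apply Rmult_le_pos; [apply pow_le; auto | apply mpow_nonneg; auto].
  - apply Rmult_le_pos; auto.
Qed.

Lemma mpow_row_sum N M n : (forall i, (i < N)%nat -> rsum N (fun j => M i j) = 1) ->
  forall i, (i < N)%nat -> rsum N (fun j => mpow N M n i j) = 1.
Proof.
  intros HM. induction n; intros i Hi; simpl.
  - rewrite (rsum_ext N _ (fun l => (if Nat.eq_dec i l then 1 else 0) * 1)) by (intros; ring).
    apply (rsum_delta N i (fun _ => 1)); auto.
  - rewrite rsum_swap. rewrite <- (IHn i Hi). apply rsum_ext; intros l Hl.
    rewrite rsum_scal_l, HM by auto. ring.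
Qed.

Definition trpow (N : nat) (M : nat -> nat -> R) (t : nat) : R :=
  rsum N (fun i => mpow N M t i i).

Lemma trpow_add N M a b :
  trpow N M (a + b) = rsum N (fun i => rsum N (fun j => mpow N M a i j * mpow N M b j i)).
Proof. apply rsum_ext; intros. apply mpow_add; auto. Qed.

(** * Primitivity *)

Section Semigroup.
Variable G : nat -> Prop.
Hypothesis Gadd : forall a b, G a -> G b -> G (a + b)%nat.

Lemma semigroup_mul a k : G a -> (1 <= k)%nat -> G (k * a)%nat.
Proof.
  intros Ha Hk. induction k as [|k IH]; [lia|].
  destruct k; [simpl; rewrite Nat.add_0_r; auto|].
  simpl. apply Gadd; auto. apply IH; lia.
Qed.

(* Take [d] minimal among the positive differences of elements of [G]; dividing by [d]
   shows that [d] divides every element. *)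
Lemma semigroup_consecutive : (exists a, G a /\ (1 <= a)%nat) ->
  (forall d, (forall n, (1 <= n)%nat -> G n -> Nat.divide d n) -> d = 1%nat) ->
  exists a, (1 <= a)%nat /\ G a /\ G (a + 1)%nat.
Proof.
  intros [a0 [Ha0 Ha0']] Hgcd.
  set (D := fun d => (1 <= d)%nat /\ exists a, (1 <= a)%nat /\ G a /\ G (a + d)%nat).
  assert (Hmin : exists d, D d /\ forall e, D e -> (d <= e)%nat).
  { destruct (dec_inh_nat_subset_has_unique_least_element D) as [d [[Hd Hmin] _]].
    - intros n. apply classic.
    - exists a0. split; auto. exists a0; repeat split; auto.
    - exists d; auto. }
  destruct Hmin as [d [[Hd [a [Ha [Ga Gad]]]] Hmin]].
  assert (d = 1%nat) as ->; [|exists a; auto].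
  apply Hgcd. intros n Hn Gn.
  pose proof (Nat.div_mod n d ltac:(lia)) as Hdm.
  pose proof (Nat.mod_upper_bound n d ltac:(lia)) as Hlt.
  set (q := (n / d)%nat) in *. set (r := (n mod d)%nat) in *.
  destruct (Nat.eq_dec r 0) as [Hr|Hr]; [exists q; lia|].
  exfalso.
  (* [q a + n = q (a + d) + r], so [r < d] is again a difference of elements of [G]. *)
  assert (Hq : D r).
  { split; [lia|].
    (* For [q = 0] the multiple [q (a + d)] is 0, which need not lie in [G]; but then [r = n] is in
       [G], and [a] itself serves as base point. *)
    destruct (Nat.eq_dec q 0) as [Hq|Hq].
    - exists a. repeat split; auto. replace r with n by (rewrite Hdm, Hq; lia). auto.
    - exists (q * (a + d))%nat. repeat split; [nia| |].
      + apply semigroup_mul; auto; lia.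
      + replace (q * (a + d) + r)%nat with (q * a + n)%nat by (rewrite Hdm; ring).
        apply Gadd; auto. apply semigroup_mul; auto; lia. }
  specialize (Hmin r Hq). lia.
Qed.

(** With [a] and [a + 1] in [G], write [n = q a + r = (q - r) a + r (a + 1)]. The bound [a * a + a]
    makes [q > r], so [q - r] is a positive multiplier, as [semigroup_mul] requires. *)
Lemma semigroup_cofinite : (exists a, G a /\ (1 <= a)%nat) ->
  (forall d, (forall n, (1 <= n)%nat -> G n -> Nat.divide d n) -> d = 1%nat) ->
  exists n0, forall n, (n0 <= n)%nat -> G n.
Proof.
  intros H0 Hg. destruct (semigroup_consecutive H0 Hg) as [a [Ha [Ga Ga1]]].
  exists (a * a + a)%nat. intros n Hn.
  pose proof (Nat.div_mod n a ltac:(lia)) as Hdm.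
  pose proof (Nat.mod_upper_bound n a ltac:(lia)) as Hlt.
  set (q := (n / a)%nat) in *. set (r := (n mod a)%nat) in *.
  assert (r < q)%nat by nia.
  destruct (Nat.eq_dec r 0) as [Hr|Hr].
  - replace n with (q * a)%nat by nia. apply semigroup_mul; auto; lia.
  - replace n with ((q - r) * a + r * (a + 1))%nat by nia.
    apply Gadd; apply semigroup_mul; auto; lia.
Qed.
End Semigroup.

Lemma eventually_uniform N (Q : nat -> nat -> Prop) :
  (forall i, (i < N)%nat -> exists n0, forall n, (n0 <= n)%nat -> Q i n) ->
  exists n0, forall i n, (i < N)%nat -> (n0 <= n)%nat -> Q i n.
Proof.
  induction N; intros H; [exists O; intros; lia|].
  destruct IHN as [n1 H1]; [intros; apply H; lia|].
  destruct (H N ltac:(lia)) as [n2 H2].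
  exists (Nat.max n1 n2). intros i n Hi Hn.
  destruct (Nat.eq_dec i N) as [->|]; [apply H2; lia | apply H1; lia].
Qed.

Lemma mpow_eventually_pos N P : nonneg_mx N P -> irreducible N P -> aperiodic N P ->
  exists n0, forall n i j, (n0 <= n)%nat -> (i < N)%nat -> (j < N)%nat -> 0 < mpow N P n i j.
Proof.
  intros HP Hirr Hap.
  assert (Hret : forall i, (i < N)%nat -> exists n0, forall n, (n0 <= n)%nat -> 0 < mpow N P n i i).
  { intros i Hi. apply (semigroup_cofinite (fun n => 0 < mpow N P n i i)).
    - intros a b Ha Hb. apply (mpow_pos_add N P a b i i i); auto.
    - destruct (classic (exists n, (1 <= n)%nat /\ 0 < mpow N P n i i)) as [[n [h1 h2]]|Hno]; [exists n; auto|].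
      (* Without a positive return time every [d] divides all return times vacuously, so
         aperiodicity applied to [d = 2] is absurd. *)
      exfalso. assert (2 = 1)%nat; [|lia]. apply (Hap i Hi). intros n Hn Hn'. exfalso. eauto.
    - intros d Hd. apply (Hap i Hi). auto. }
  assert (H : forall i, (i < N)%nat -> exists n0, forall n, (n0 <= n)%nat ->
                 forall j, (j < N)%nat -> 0 < mpow N P n i j).
  { intros i Hi.
    destruct (eventually_uniform N (fun j n => 0 < mpow N P n i j)) as [n0 H0].
    - intros j Hj. destruct (Hirr i j Hi Hj) as [k Hk]. destruct (Hret i Hi) as [n0 H0].
      exists (n0 + k)%nat. intros n Hn. replace n with ((n - k) + k)%nat by lia.
      apply (mpow_pos_add N P _ _ i i j); auto. apply H0; lia.
    - exists n0. auto. }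
  destruct (eventually_uniform N _ H) as [n0 H0]. exists n0. intros. apply H0; auto.
Qed.

(** * Closed walks *)

Lemma exp_ge_tangent c x : exp c * (1 + x - c) <= exp x.
Proof.
  replace x with (c + (x - c)) at 2 by ring. rewrite exp_plus.
  apply Rmult_le_compat_l; [left; apply exp_pos|].
  pose proof (exp_ineq1_le (x - c)). lra.
Qed.

(** Sum the tangent lines of [exp] at the weighted mean. The weights are not normalized, so that
    entries of matrix powers fit directly; total weight 0 is allowed because the quotient is then
    multiplied by 0. *)
Lemma jensen_exp n w x : (forall l, (l < n)%nat -> 0 <= w l) ->
  rsum n w * exp (rsum n (fun l => w l * x l) / rsum n w) <= rsum n (fun l => w l * exp (x l)).
Proof.
  intros Hw. destruct (Rle_lt_or_eq_dec 0 (rsum n w) (rsum_nonneg _ _ Hw)) as [HW|HW].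
  - set (W := rsum n w) in *. set (c := rsum n (fun l => w l * x l) / W).
    replace (W * exp c) with (rsum n (fun l => w l * (exp c * (1 + x l - c)))).
    + apply rsum_le; intros l Hl. apply Rmult_le_compat_l; auto. apply exp_ge_tangent.
    + rewrite (rsum_ext n _ (fun l => exp c * (1 - c) * w l + exp c * (w l * x l))) by (intros; ring).
      rewrite rsum_plus, !rsum_scal_l. fold W.
      replace (rsum n (fun l => w l * x l)) with (W * c) by (unfold c; field; lra). ring.
  - rewrite <- HW, Rmult_0_l. apply rsum_nonneg; intros.
    apply Rmult_le_pos; auto. left; apply exp_pos.
Qed.

Lemma exp_le_compat x y : x <= y -> exp x <= exp y.
Proof. intros [H| ->]; [left; apply exp_increasing; auto | lra]. Qed.

Lemma ln_le_compat x y : 0 < x -> x <= y -> ln x <= ln y.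
Proof. intros Hx [H| ->]; [left; apply ln_increasing; auto | lra]. Qed.

Lemma ln_le_exp x y : 0 < x -> x <= exp y -> ln x <= y.
Proof. intros Hx H. rewrite <- (ln_exp y). apply ln_le_compat; auto. Qed.

(* Derivative of [mpow N (M * exp (u K)) t] at [u = 0], the product being entrywise. *)
Fixpoint mder (N : nat) (M K : nat -> nat -> R) (t i j : nat) : R :=
  match t with
  | O => 0
  | S t => rsum N (fun l => mder N M K t i l * M l j + mpow N M t i l * (M l j * K l j))
  end.

(** Allows the logarithmic derivative [mder / mpow] to be multiplied back by [mpow] even where the
    division is by 0. *)
Lemma mder_eq0 N M K t i j : nonneg_mx N M -> (i < N)%nat -> (j < N)%nat ->
  mpow N M t i j = 0 -> mder N M K t i j = 0.
Proof.
  intros HM Hi. revert j. induction t; intros j Hj H0; simpl in *; auto.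
  apply rsum_0; intros l Hl.
  assert (Hz : mpow N M t i l * M l j = 0).
  { apply (rsum_nonneg_eq0 N (fun l => mpow N M t i l * M l j)); auto.
    intros. apply Rmult_le_pos; auto. apply mpow_nonneg; auto. }
  destruct (Rmult_integral _ _ Hz) as [h|h].
  - rewrite h, IHt by auto. ring.
  - rewrite h. ring.
Qed.

(** As a function of [u], the logarithm of an entry of the power of [M * exp (u K)] is convex, with
    slope [mder / mpow] at [u = 0]; this is its tangent inequality at [u = 1]. Peeling off the last
    step reduces it to Jensen. *)
Lemma mpow_tilt_ge N M K t i j : nonneg_mx N M -> (i < N)%nat -> (j < N)%nat ->
  mpow N M t i j * exp (mder N M K t i j / mpow N M t i j)
  <= mpow N (fun i j => M i j * exp (K i j)) t i j.
Proof.
  intros HM Hi. revert j. induction t; intros j Hj; simpl.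
  - unfold Rdiv. rewrite Rmult_0_l, exp_0. lra.
  - set (w := fun l => mpow N M t i l * M l j).
    assert (Hw : forall l, (l < N)%nat -> 0 <= w l).
    { intros. apply Rmult_le_pos; auto. apply mpow_nonneg; auto. }
    set (x := fun l => mder N M K t i l / mpow N M t i l + K l j).
    replace (rsum N (fun l => mder N M K t i l * M l j + mpow N M t i l * (M l j * K l j)))
      with (rsum N (fun l => w l * x l)).
    + eapply Rle_trans; [apply jensen_exp; auto|].
      apply rsum_le; intros l Hl. unfold w, x. rewrite exp_plus.
      replace (mpow N M t i l * M l j * (exp (mder N M K t i l / mpow N M t i l) * exp (K l j)))
        with ((mpow N M t i l * exp (mder N M K t i l / mpow N M t i l)) * (M l j * exp (K l j))) by ring.
      apply Rmult_le_compat_r; auto. apply Rmult_le_pos; auto. left; apply exp_pos.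
    + apply rsum_ext; intros l Hl. unfold w, x.
      destruct (Req_EM_T (mpow N M t i l) 0) as [e|e].
      * rewrite (mder_eq0 N M K t i l), e by auto. ring.
      * field; auto.
Qed.

(** Cyclicity of the trace: each of the [t] positions of the step that carries [K] contributes the
    same amount. The [m] extra plain steps make the induction work, since a last step without [K] is
    passed on to them. *)
Lemma mder_trace N M K t : forall m r, (t + m = S r)%nat ->
  rsum N (fun i => rsum N (fun j => mder N M K t i j * mpow N M m j i)) =
  INR t * rsum N (fun i => rsum N (fun j => M i j * K i j * mpow N M r j i)).
Proof.
  induction t; intros m r Hr.
  - simpl. rewrite Rmult_0_l. apply rsum_0; intros. apply rsum_0; intros. ring.
  - rewrite S_INR, Rmult_plus_distr_r, Rmult_1_l. rewrite <- (IHt (S m) r) by lia.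
    rewrite (rsum2_ext N _ (fun i j =>
       rsum N (fun l => mder N M K t i l * M l j * mpow N M m j i) +
       rsum N (fun l => mpow N M t i l * (M l j * K l j) * mpow N M m j i))).
    2:{ intros. simpl. rewrite <- rsum_plus, <- rsum_scal_r. apply rsum_ext; intros; ring. }
    rewrite rsum2_plus. f_equal.
    + apply rsum_ext; intros i Hi. rewrite rsum_swap. apply rsum_ext; intros l Hl.
      rewrite mpow_S_l by auto. rewrite <- rsum_scal_l. apply rsum_ext; intros; ring.
    + rewrite rsum_swap.
      rewrite (rsum2_ext N (fun i j => M i j * K i j * mpow N M r j i)
        (fun l j => rsum N (fun i => mpow N M t i l * (M l j * K l j) * mpow N M m j i))).
      * symmetry. rewrite rsum_swap. apply rsum_ext; intros j Hj. apply rsum_swap.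
      * intros l j Hl Hj. replace r with (m + t)%nat by lia. rewrite mpow_add by auto.
        rewrite <- rsum_scal_l. apply rsum_ext; intros; ring.
Qed.

(* The pair frequencies of a closed walk of length [S t] drawn with probability proportional
   to the product of the entries of [M] along it. *)
Definition closed_walk_freq (N : nat) (M : nat -> nat -> R) (t i j : nat) : R :=
  M i j * mpow N M t j i / trpow N M (S t).

Section ClosedWalk.
Variables (N : nat) (M : nat -> nat -> R) (t : nat).
Hypothesis HN : (0 < N)%nat.
Hypothesis HM : nonneg_mx N M.
Hypothesis Hpos : forall i j, (i < N)%nat -> (j < N)%nat -> 0 < mpow N M t i j.
Hypothesis HposS : forall i j, (i < N)%nat -> (j < N)%nat -> 0 < mpow N M (S t) i j.

Lemma trpow_pos : 0 < trpow N M (S t).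
Proof. apply (rsum_pos N _ O); auto. intros; left; auto. Qed.

Lemma closed_walk_freq_pos i j : (i < N)%nat -> (j < N)%nat -> 0 < M i j ->
  0 < closed_walk_freq N M t i j.
Proof.
  intros Hi Hj H. apply Rdiv_lt_0_compat; [|apply trpow_pos].
  apply Rmult_lt_0_compat; auto.
Qed.

Lemma closed_walk_freq_eq0 i j : M i j = 0 -> closed_walk_freq N M t i j = 0.
Proof. intros H. unfold closed_walk_freq. rewrite H. unfold Rdiv. ring. Qed.

Lemma closed_walk_freq_bar i : (i < N)%nat ->
  theta_bar N (closed_walk_freq N M t) i = mpow N M (S t) i i / trpow N M (S t).
Proof.
  intros Hi. unfold theta_bar, closed_walk_freq, Rdiv.
  rewrite rsum_scal_r. f_equal. rewrite mpow_S_l by auto. reflexivity.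
Qed.

Lemma closed_walk_freq_bar_pos i : (i < N)%nat -> 0 < theta_bar N (closed_walk_freq N M t) i.
Proof.
  intros Hi. rewrite closed_walk_freq_bar by auto.
  apply Rdiv_lt_0_compat; auto. apply trpow_pos.
Qed.

Lemma closed_walk_freq_nonneg : nonneg_mx N (closed_walk_freq N M t).
Proof.
  intros i j Hi Hj. destruct (Rle_lt_or_eq_dec 0 (M i j) (HM i j Hi Hj)) as [h|h].
  - left; apply closed_walk_freq_pos; auto.
  - rewrite closed_walk_freq_eq0; auto; lra.
Qed.

(** Balance is exact, without boundary terms, because [M * M^t] and [M^t * M] have the same
    diagonal. *)
Lemma closed_walk_freq_in_Delta P :
  (forall i j, (i < N)%nat -> (j < N)%nat -> ~ 0 < P i j -> M i j = 0) ->
  in_Delta N P (closed_walk_freq N M t).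
Proof.
  intros HMP. pose proof trpow_pos as HZ. split; [|split; [|split]].
  - apply closed_walk_freq_nonneg.
  - rewrite (rsum_ext N _ (fun i => mpow N M (S t) i i * / trpow N M (S t))).
    + rewrite rsum_scal_r. unfold trpow in *. field. lra.
    + intros i Hi. apply closed_walk_freq_bar; auto.
  - intros i Hi. change (theta_bar N (closed_walk_freq N M t) i = rsum N (fun j => closed_walk_freq N M t j i)).
    rewrite closed_walk_freq_bar by auto.
    unfold closed_walk_freq, Rdiv. rewrite rsum_scal_r. f_equal.
    simpl. apply rsum_ext; intros; ring.
  - intros i j Hi Hj H. apply closed_walk_freq_eq0. auto.
Qed.

(* Gibbs' variational principle for closed walks: the entropy of the walk is at most that of
   the Markov chain with the same pair frequencies. *)
Lemma ln_trpow_le :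
  ln (trpow N M (S t)) <= ln (INR N) + INR (S t) *
    (entropy N (closed_walk_freq N M t) +
     rsum N (fun i => rsum N (fun j => closed_walk_freq N M t i j * ln (M i j)))).
Proof.
  pose proof trpow_pos as HZ. set (Z := trpow N M (S t)) in *.
  (* Chosen so that [p i j = theta i j / theta_bar i], the transition matrix with the pair
     frequencies of the closed walk. It is stochastic, so the trace of any power is at most [N]. *)
  set (K := fun i j => ln (mpow N M t j i / mpow N M (S t) i i)).
  set (p := fun i j => M i j * exp (K i j)).
  assert (Hp1 : forall i, (i < N)%nat -> rsum N (fun j => p i j) = 1).
  { intros i Hi. rewrite (rsum_ext N _ (fun j => M i j * mpow N M t j i * / mpow N M (S t) i i)).
    - rewrite rsum_scal_r, <- mpow_S_l by auto. apply Rinv_r. specialize (HposS i i Hi Hi). lra.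
    - intros j Hj. unfold p, K. rewrite exp_ln; [unfold Rdiv; ring|].
      apply Rdiv_lt_0_compat; auto. }
  assert (Hp : nonneg_mx N p).
  { intros i j Hi Hj. apply Rmult_le_pos; auto. left; apply exp_pos. }
  assert (Htr : trpow N p (S t) <= INR N).
  { rewrite <- (Rmult_1_r (INR N)), <- rsum_const. apply rsum_le; intros i Hi.
    rewrite <- (mpow_row_sum N p (S t) Hp1 i Hi).
    apply (rsum_ge_term N (fun j => mpow N p (S t) i j)); auto. intros. apply mpow_nonneg; auto. }
  (* The mean of the sum of [K] along the random closed walk; Jensen is used once more, now over the
     starting state. *)
  set (c := rsum N (fun i => mder N M K (S t) i i) / Z).
  assert (Hge : Z * exp c <= trpow N p (S t)).
  { unfold c, Z, trpow.
    replace (rsum N (fun i => mder N M K (S t) i i)) with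
      (rsum N (fun i => mpow N M (S t) i i * (mder N M K (S t) i i / mpow N M (S t) i i))).
    - eapply Rle_trans; [apply (jensen_exp N (fun i => mpow N M (S t) i i))|].
      + intros; left; auto.
      + apply rsum_le; intros i Hi. apply mpow_tilt_ge; auto.
    - apply rsum_ext; intros i Hi. field. specialize (HposS i i Hi Hi). lra. }
  assert (Hln : ln Z + c <= ln (INR N)).
  { rewrite <- (ln_exp c) at 1. rewrite <- ln_mult; auto using exp_pos.
    apply ln_le_compat; [apply Rmult_lt_0_compat; auto using exp_pos | lra]. }
  assert (Hder : rsum N (fun i => mder N M K (S t) i i) =
     INR (S t) * rsum N (fun i => rsum N (fun j => M i j * K i j * mpow N M t j i))).
  { rewrite <- (mder_trace N M K (S t) O t) by lia. apply rsum_ext; intros i Hi.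
    rewrite <- (rsum_delta N i (fun j => mder N M K (S t) i j)) by auto.
    apply rsum_ext; intros j Hj. simpl (mpow N M 0 j i).
    destruct (Nat.eq_dec i j), (Nat.eq_dec j i); subst; try congruence; ring. }
  (* Since [theta i j / theta_bar i = M i j * exp (K i j)], the terms in [ln (M i j)] cancel and
     minus the mean of [K] remains. *)
  assert (Hent : entropy N (closed_walk_freq N M t) +
     rsum N (fun i => rsum N (fun j => closed_walk_freq N M t i j * ln (M i j))) =
     - (rsum N (fun i => rsum N (fun j => M i j * K i j * mpow N M t j i)) / Z)).
  { unfold entropy. unfold Rdiv at 2. rewrite <- rsum_scal_r.
    match goal with |- - ?a + ?b = - ?d => cut (a = b + d); [lra|] end.
    rewrite <- rsum_plus. apply rsum_ext; intros i Hi.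
    rewrite <- rsum_scal_r, <- rsum_plus. apply rsum_ext; intros j Hj.
    destruct (Rle_lt_or_eq_dec 0 (M i j) (HM i j Hi Hj)) as [h|h].
    - pose proof (closed_walk_freq_pos i j Hi Hj h) as Hth.
      destruct (Req_EM_T (closed_walk_freq N M t i j) 0) as [e|e]; [lra|].
      rewrite closed_walk_freq_bar by auto. fold Z.
      specialize (Hpos j i Hj Hi). specialize (HposS i i Hi Hi).
      replace (closed_walk_freq N M t i j / (mpow N M (S t) i i / Z)) with
        (M i j * (mpow N M t j i / mpow N M (S t) i i)).
      + rewrite ln_mult; auto using Rdiv_lt_0_compat. fold (K i j).
        unfold closed_walk_freq. fold Z. field. lra.
      + unfold closed_walk_freq. fold Z. field. lra.
    - rewrite closed_walk_freq_eq0 by auto. destruct (Req_EM_T 0 0); [|lra].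
      rewrite <- h. ring. }
  rewrite Hent. unfold c in Hln. rewrite Hder in Hln.
  unfold Rdiv in *. lra.
Qed.
End ClosedWalk.

(** * The tilted chain *)

Lemma continuity_rsum n (f : R -> nat -> R) :
  (forall i, (i < n)%nat -> continuity (fun s => f s i)) ->
  continuity (fun s => rsum n (f s)).
Proof.
  induction n; simpl; intros H.
  - apply continuity_const. intros x y; reflexivity.
  - apply (continuity_plus (fun s => rsum n (f s)) (fun s => f s n)); auto.
Qed.

Lemma continuity_mpow N (A : R -> nat -> nat -> R) n :
  (forall i j, (i < N)%nat -> (j < N)%nat -> continuity (fun s => A s i j)) ->
  forall i j, (i < N)%nat -> (j < N)%nat -> continuity (fun s => mpow N (A s) n i j).
Proof.
  intros HA. induction n; intros i j Hi Hj; simpl.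
  - apply continuity_const. intros x y; reflexivity.
  - apply (continuity_rsum N (fun s l => mpow N (A s) n i l * A s l j)). intros l Hl.
    apply (continuity_mult (fun s => mpow N (A s) n i l) (fun s => A s l j)); auto.
Qed.

Lemma continuity_div_pos (f g : R -> R) : (forall s, 0 < g s) ->
  continuity f -> continuity g -> continuity (fun s => f s / g s).
Proof.
  intros H Hf Hg. apply (continuity_div f g); auto. intros s. specialize (H s). lra.
Qed.

Lemma continuity_ln_pos (g : R -> R) : (forall s, 0 < g s) ->
  continuity g -> continuity (fun s => ln (g s)).
Proof.
  intros H Hg s. apply (continuity_pt_comp g ln); [apply Hg|].
  apply derivable_continuous_pt. exists (/ g s). apply derivable_pt_lim_ln. auto.
Qed.

(** Complementary slackness: either the constraint already holds at [s = 1], where the multiplier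
    [(1 - s) / s] vanishes, or [f] changes sign and is 0 in between. *)
Lemma ivt_slack (f : R -> R) s0 : continuity f -> s0 <= 1 -> 0 <= f s0 ->
  exists s, s0 <= s <= 1 /\ 0 <= f s /\ (1 - s) * f s = 0.
Proof.
  intros Hf Hs H0. destruct (Rle_dec 0 (f 1)) as [h|h].
  - exists 1. repeat split; auto; lra.
  - destruct (IVT_cor f s0 1 Hf Hs) as [s [Hs' Hz]]; [nra|].
    exists s. rewrite Hz. repeat split; lra.
Qed.

Lemma mpow_pos_support N A B n : nonneg_mx N A -> nonneg_mx N B ->
  (forall i j, (i < N)%nat -> (j < N)%nat -> 0 < A i j -> 0 < B i j) ->
  forall i j, (i < N)%nat -> (j < N)%nat -> 0 < mpow N A n i j -> 0 < mpow N B n i j.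
Proof.
  intros HA HB H. induction n; intros i j Hi Hj; simpl; auto.
  intros Hp. destruct (rsum_pos_inv _ _ Hp) as [l [Hl Hlp]].
  pose proof (mpow_nonneg N A n HA i l Hi Hl). pose proof (HA l j Hl Hj).
  apply (rsum_pos N _ l); auto.
  - intros; apply Rmult_le_pos; auto; apply mpow_nonneg; auto.
  - apply Rmult_lt_0_compat; [apply IHn | apply H]; auto; nra.
Qed.

(** Replaces the integrality of walk counts: a sum of products of entries that are 0 or at least 1
    is again 0 or at least 1. *)
Lemma mpow_ge_1 N A n : nonneg_mx N A ->
  (forall i j, (i < N)%nat -> (j < N)%nat -> 0 < A i j -> 1 <= A i j) ->
  forall i j, (i < N)%nat -> (j < N)%nat -> 0 < mpow N A n i j -> 1 <= mpow N A n i j.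
Proof.
  intros HA H. induction n; intros i j Hi Hj; simpl.
  - destruct (Nat.eq_dec i j); lra.
  - intros Hp. destruct (rsum_pos_inv _ _ Hp) as [l [Hl Hlp]].
    pose proof (mpow_nonneg N A n HA i l Hi Hl). pose proof (HA l j Hl Hj).
    assert (1 <= mpow N A n i l) by (apply IHn; auto; nra).
    assert (1 <= A l j) by (apply H; auto; nra).
    eapply Rle_trans; [|apply (rsum_ge_term N _ l); auto].
    + nra.
    + intros; apply Rmult_le_pos; auto; apply mpow_nonneg; auto.
Qed.

Lemma mpow_upper N A n : nonneg_mx N A ->
  (forall i j, (i < N)%nat -> (j < N)%nat -> A i j <= 1) ->
  forall i j, (i < N)%nat -> (j < N)%nat -> mpow N A (S n) i j <= INR N ^ n.
Proof.
  intros HA H. induction n; intros i j Hi Hj.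
  - rewrite mpow_1 by auto. simpl. auto.
  - change (rsum N (fun l => mpow N A (S n) i l * A l j) <= INR N * INR N ^ n).
    rewrite <- rsum_const. apply rsum_le; intros l Hl.
    pose proof (mpow_nonneg N A (S n) HA i l Hi Hl). pose proof (HA l j Hl Hj).
    specialize (IHn i l Hi Hl). specialize (H l j Hl Hj).
    apply Rle_trans with (mpow N A (S n) i l * 1); [apply Rmult_le_compat_l; auto | lra].
Qed.

Lemma trpow_upper N A n : nonneg_mx N A -> (1 <= n)%nat ->
  (forall i j, (i < N)%nat -> (j < N)%nat -> A i j <= 1) ->
  trpow N A n <= INR N ^ n.
Proof.
  intros HA Hn H. destruct n as [|n]; [lia|]. simpl. rewrite <- rsum_const.
  apply rsum_le; intros i Hi. apply mpow_upper; auto.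
Qed.

(** Walks are concatenated from [m] blocks of length [r]; the state at each junction is free, which
    gives [N] choices per block. *)
Lemma trpow_lower N A r m : nonneg_mx N A ->
  (forall i j, (i < N)%nat -> (j < N)%nat -> 1 <= mpow N A r i j) -> (1 <= m)%nat ->
  INR N ^ m <= trpow N A (r * m).
Proof.
  intros HA H Hm. destruct m as [|m]; [lia|]. clear Hm.
  assert (Hall : forall i j, (i < N)%nat -> (j < N)%nat -> INR N ^ m <= mpow N A (r * S m) i j).
  { induction m; intros i j Hi Hj.
    - rewrite Nat.mul_1_r. simpl. auto.
    - replace (r * S (S m))%nat with (r * S m + r)%nat by ring. rewrite mpow_add by auto.
      simpl. rewrite <- rsum_const. apply rsum_le; intros l Hl.
      rewrite <- (Rmult_1_r (INR N ^ m)). apply Rmult_le_compat; auto; try lra.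
      apply pow_le, pos_INR. }
  simpl. rewrite <- rsum_const. apply rsum_le; intros; auto.
Qed.

(* One-step factors of [E_0 (P(s^t) exp (...))^s] for the Gaussian likelihood ratio. *)
Definition tilt (P : nat -> nat -> R) (beta : nat -> R) (s : R) (i j : nat) : R :=
  if Rlt_dec 0 (P i j) then exp (s * ln (P i j) + (s ^ 2 - s) * beta i ^ 2 / 2) else 0.

Section Tilt.
Variables (N : nat) (P : nat -> nat -> R) (beta : nat -> R) (kappa : R) (r0 : nat).
Hypothesis HN : (0 < N)%nat.
Hypothesis HP : row_stochastic N P.
Hypothesis Hkappa : forall i j, (i < N)%nat -> (j < N)%nat -> Rabs (ln (P i j)) + beta i ^ 2 <= kappa.
Hypothesis Hr0 : (1 <= r0)%nat.
Hypothesis Hprim : forall n i j, (r0 <= n)%nat -> (i < N)%nat -> (j < N)%nat -> 0 < mpow N P n i j.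

Lemma tilt_nonneg s : nonneg_mx N (tilt P beta s).
Proof. intros i j _ _. unfold tilt. destruct Rlt_dec; [left; apply exp_pos | lra]. Qed.

Lemma tilt_pos s i j : 0 < P i j -> 0 < tilt P beta s i j.
Proof. intros. unfold tilt. destruct Rlt_dec; [apply exp_pos | lra]. Qed.

Lemma tilt_eq0 s i j : ~ 0 < P i j -> tilt P beta s i j = 0.
Proof. intros. unfold tilt. destruct Rlt_dec; [lra | auto]. Qed.

Lemma stochastic_nonneg : nonneg_mx N P.
Proof. exact (proj1 HP). Qed.

Lemma stochastic_le_1 i j : (i < N)%nat -> (j < N)%nat -> P i j <= 1.
Proof.
  intros Hi Hj. destruct HP as [H1 H2]. rewrite <- (H2 i Hi).
  apply (rsum_ge_term N (fun j => P i j)); auto.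
Qed.

Lemma kappa_nonneg : 0 <= kappa.
Proof. pose proof (Hkappa O O HN HN). pose proof (Rabs_pos (ln (P O O))). nra. Qed.

Lemma ln_stochastic i j : (i < N)%nat -> (j < N)%nat -> 0 < P i j ->
  ln (P i j) <= 0 /\ - ln (P i j) + beta i ^ 2 <= kappa.
Proof.
  intros Hi Hj H. split.
  - apply ln_le_exp; auto. rewrite exp_0. apply stochastic_le_1; auto.
  - pose proof (Hkappa i j Hi Hj). pose proof (Rle_abs (- ln (P i j))). rewrite Rabs_Ropp in *. lra.
Qed.

Lemma tilt_le_1 s i j : 0 <= s <= 1 -> (i < N)%nat -> (j < N)%nat -> tilt P beta s i j <= 1.
Proof.
  intros Hs Hi Hj. unfold tilt. destruct Rlt_dec as [h|h]; [|lra].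
  rewrite <- exp_0. apply exp_le_compat. pose proof (ln_stochastic i j Hi Hj h).
  assert (0 <= (s - s^2) * beta i ^ 2) by (apply Rmult_le_pos; nra).
  nra.
Qed.

Lemma tilt_mpow_pos s n i j : (r0 <= n)%nat -> (i < N)%nat -> (j < N)%nat ->
  0 < mpow N (tilt P beta s) n i j.
Proof.
  intros Hn Hi Hj. apply (mpow_pos_support N P); auto using stochastic_nonneg, tilt_nonneg.
  intros; apply tilt_pos; auto.
Qed.

(** [tilt P beta 0] is the 0/1 adjacency matrix of the edges. Raising [s] from 0 costs at most a
    factor [exp (- kappa s)] per step, negligible for small [s]. *)
Lemma tilt_ge_tilt0 s i j : 0 <= s <= 1 -> (i < N)%nat -> (j < N)%nat ->
  exp (- (kappa * s)) * tilt P beta 0 i j <= tilt P beta s i j.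
Proof.
  intros Hs Hi Hj. unfold tilt. destruct Rlt_dec as [h|h]; [|lra].
  rewrite <- exp_plus. apply exp_le_compat. pose proof (ln_stochastic i j Hi Hj h).
  assert (0 <= s^2 * beta i ^ 2) by (apply Rmult_le_pos; nra).
  nra.
Qed.

Lemma tilt_0_mpow_ge_1 n i j : (r0 <= n)%nat -> (i < N)%nat -> (j < N)%nat ->
  1 <= mpow N (tilt P beta 0) n i j.
Proof.
  intros Hn Hi Hj. apply mpow_ge_1; auto using tilt_nonneg, tilt_mpow_pos.
  intros k l _ _. unfold tilt. destruct Rlt_dec; [|lra]. intros _.
  replace (0 * ln (P k l) + (0 ^ 2 - 0) * beta k ^ 2 / 2) with 0 by field. rewrite exp_0. lra.
Qed.

Lemma exp_pow x n : exp x ^ n = exp (INR n * x).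
Proof.
  induction n; [simpl; rewrite Rmult_0_l, exp_0; reflexivity|].
  simpl pow. rewrite IHn, <- exp_plus, S_INR. f_equal; ring.
Qed.

Lemma tilt_mpow_ge s n i j : 0 <= s <= 1 -> (i < N)%nat -> (j < N)%nat ->
  exp (- (kappa * s * INR n)) * mpow N (tilt P beta 0) n i j <= mpow N (tilt P beta s) n i j.
Proof.
  intros Hs Hi Hj.
  replace (exp (- (kappa * s * INR n))) with (exp (- (kappa * s)) ^ n)
    by (rewrite exp_pow; f_equal; ring).
  apply mpow_scal_le; auto using tilt_nonneg.
  - left; apply exp_pos.
  - intros; apply tilt_ge_tilt0; auto.
Qed.

(** Walk counting at [s = 0] transferred to small [s]. Against the Gibbs upper bound it forces the
    entropy of the closed walk to be bounded below uniformly in its length. *)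
Lemma ln_trpow_tilt_ge s m : 0 <= s <= 1 -> (1 <= m)%nat ->
  INR m * ln (INR N) - kappa * s * INR (r0 * m) <= ln (trpow N (tilt P beta s) (r0 * m)).
Proof.
  intros Hs Hm. assert (HN' : 0 < INR N) by (apply lt_0_INR; auto).
  rewrite <- (ln_exp (_ - _)). apply ln_le_compat; [apply exp_pos|].
  unfold Rminus. rewrite Rplus_comm, exp_plus, <- ln_pow, exp_ln by auto using pow_lt.
  eapply Rle_trans.
  - apply Rmult_le_compat_l; [left; apply exp_pos|].
    apply (trpow_lower N (tilt P beta 0) r0 m); auto using tilt_nonneg.
    intros; apply tilt_0_mpow_ge_1; auto.
  - unfold trpow. rewrite <- rsum_scal_l. apply rsum_le; intros. apply tilt_mpow_ge; auto.
Qed.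

Lemma continuity_tilt i j : continuity (fun s => tilt P beta s i j).
Proof.
  unfold tilt. destruct Rlt_dec as [h|h].
  - apply (continuity_comp (fun s => s * ln (P i j) + (s ^ 2 - s) * beta i ^ 2 / 2) exp).
    + apply derivable_continuous. intros x. reg.
    + apply derivable_continuous. apply derivable_exp.
  - apply continuity_const. intros x y; reflexivity.
Qed.

Section Freq.
Variable t : nat.
Hypothesis Ht : (r0 <= t)%nat.
Let theta s := closed_walk_freq N (tilt P beta s) t.
Let energy s := rsum N (fun i => theta_bar N (theta s) i * beta i ^ 2).
Let logP s := rsum N (fun i => rsum N (fun j => theta s i j * ln (P i j))).

Let HposT s i j : (i < N)%nat -> (j < N)%nat -> 0 < mpow N (tilt P beta s) t i j.
Proof. intros; apply tilt_mpow_pos; auto. Qed.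

Let HposST s i j : (i < N)%nat -> (j < N)%nat -> 0 < mpow N (tilt P beta s) (S t) i j.
Proof. intros; apply tilt_mpow_pos; auto. Qed.

Lemma tilt_freq_pos s i j : (i < N)%nat -> (j < N)%nat -> 0 < P i j -> 0 < theta s i j.
Proof. intros. apply closed_walk_freq_pos; auto using tilt_pos, tilt_nonneg. Qed.

Lemma tilt_freq_eq0 s i j : ~ 0 < P i j -> theta s i j = 0.
Proof. intros. apply closed_walk_freq_eq0, tilt_eq0; auto. Qed.

Lemma tilt_freq_bar_pos s i : (i < N)%nat -> 0 < theta_bar N (theta s) i.
Proof. intros. apply closed_walk_freq_bar_pos; auto. Qed.

Lemma tilt_freq_in_Delta s : in_Delta N P (theta s).
Proof. apply closed_walk_freq_in_Delta; auto using tilt_nonneg, tilt_eq0. Qed.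

Lemma tilt_freq_gibbs s :
  ln (trpow N (tilt P beta s) (S t)) <=
  ln (INR N) + INR (S t) * (entropy N (theta s) + s * logP s + (s ^ 2 - s) / 2 * energy s).
Proof.
  eapply Rle_trans; [apply ln_trpow_le; auto using tilt_nonneg|]. right.
  do 2 f_equal. rewrite Rplus_assoc. f_equal.
  unfold logP, energy. rewrite <- rsum2_scal_l, <- rsum_scal_l, <- rsum_plus.
  apply rsum_ext; intros i Hi. unfold theta_bar.
  rewrite <- rsum_scal_r, <- rsum_scal_l, <- rsum_plus. apply rsum_ext; intros j Hj.
  fold (theta s). destruct (Rlt_dec 0 (P i j)) as [h|h].
  - unfold tilt. destruct Rlt_dec; [|lra]. rewrite ln_exp. field.
  - rewrite tilt_freq_eq0 by auto. ring.
Qed.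

Lemma tilt_freq_rel_entropy s : rel_entropy N (theta s) P = - entropy N (theta s) - logP s.
Proof.
  unfold rel_entropy, entropy, logP.
  match goal with |- ?a = - - ?b - ?c => cut (a + c = b); [lra|] end.
  rewrite <- rsum2_plus. apply rsum2_ext; intros i j Hi Hj.
  destruct (Rlt_dec 0 (P i j)) as [h|h].
  - pose proof (tilt_freq_pos s i j Hi Hj h). pose proof (tilt_freq_bar_pos s i Hi).
    destruct (Req_EM_T (theta s i j) 0) as [e|e]; [lra|].
    replace (theta s i j / (theta_bar N (theta s) i * P i j)) with
      ((theta s i j / theta_bar N (theta s) i) * / P i j) by (field; lra).
    rewrite ln_mult, ln_Rinv; auto using Rdiv_lt_0_compat, Rinv_0_lt_compat. ring.
  - rewrite tilt_freq_eq0 by auto. destruct (Req_EM_T 0 0); [ring|lra].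
Qed.

Lemma tilt_freq_objective s x :
  objective N P beta (theta s) (fun i => x * beta i * theta_bar N (theta s) i) =
  - entropy N (theta s) - logP s + (1 - x) ^ 2 / 2 * energy s.
Proof.
  unfold objective. rewrite tilt_freq_rel_entropy. f_equal.
  unfold energy. rewrite <- rsum_scal_l. apply rsum_ext; intros i Hi.
  pose proof (tilt_freq_bar_pos s i Hi). destruct Rlt_dec; [|lra]. field. lra.
Qed.

Lemma tilt_freq_feasible s x : x ^ 2 / 2 * energy s <= entropy N (theta s) ->
  feasible N P (theta s) (fun i => x * beta i * theta_bar N (theta s) i).
Proof.
  intros H. split; [|apply tilt_freq_in_Delta].
  unfold H_ge_J, J_theta. destruct excluded_middle_informative as [h|h].
  - eapply Rle_trans; [|apply H]. right. unfold energy. rewrite <- rsum_scal_l.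
    apply rsum_ext; intros i Hi.
    pose proof (tilt_freq_bar_pos s i Hi). destruct Rlt_dec; [|lra]. field. lra.
  - apply h. intros i Hi H0. pose proof (tilt_freq_bar_pos s i Hi). lra.
Qed.

Lemma tilt_freq_energy s : 0 <= energy s <= kappa.
Proof.
  split.
  - apply rsum_nonneg; intros i Hi. pose proof (tilt_freq_bar_pos s i Hi).
    apply Rmult_le_pos; nra.
  - destruct (tilt_freq_in_Delta s) as [_ [H1 _]].
    apply Rle_trans with (rsum N (fun i => theta_bar N (theta s) i * kappa)).
    + apply rsum_le; intros i Hi. pose proof (tilt_freq_bar_pos s i Hi).
      apply Rmult_le_compat_l; [lra|].
      pose proof (Hkappa i O Hi HN). pose proof (Rabs_pos (ln (P i O))). lra.
    + rewrite rsum_scal_r. unfold theta_bar. rewrite H1. lra.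
Qed.

Lemma tilt_freq_logP s : logP s <= 0.
Proof.
  rewrite <- (rsum_0 N (fun i => 0)) by auto. apply rsum_le; intros i Hi.
  rewrite <- (rsum_0 N (fun i => 0)) by auto. apply rsum_le; intros j Hj.
  destruct (Rlt_dec 0 (P i j)) as [h|h].
  - pose proof (tilt_freq_pos s i j Hi Hj h). pose proof (ln_stochastic i j Hi Hj h). nra.
  - rewrite tilt_freq_eq0 by auto. lra.
Qed.

Lemma continuity_tilt_freq i j : (i < N)%nat -> (j < N)%nat -> continuity (fun s => theta s i j).
Proof.
  intros Hi Hj. unfold theta, closed_walk_freq.
  apply (continuity_div_pos (fun s => tilt P beta s i j * mpow N (tilt P beta s) t j i)
          (fun s => trpow N (tilt P beta s) (S t))).
  - intros s. apply trpow_pos; auto.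
  - apply (continuity_mult (fun s => tilt P beta s i j) (fun s => mpow N (tilt P beta s) t j i)).
    + apply continuity_tilt.
    + apply continuity_mpow; auto using continuity_tilt.
  - apply (continuity_rsum N (fun s i => mpow N (tilt P beta s) (S t) i i)).
    intros; apply continuity_mpow; auto using continuity_tilt.
Qed.

Lemma continuity_tilt_freq_bar i : (i < N)%nat -> continuity (fun s => theta_bar N (theta s) i).
Proof.
  intros Hi. apply (continuity_rsum N (fun s j => theta s i j)).
  intros; apply continuity_tilt_freq; auto.
Qed.

Lemma continuity_energy : continuity energy.
Proof.
  apply (continuity_rsum N (fun s i => theta_bar N (theta s) i * beta i ^ 2)). intros i Hi.
  apply (continuity_mult (fun s => theta_bar N (theta s) i) (fun _ => beta i ^ 2)).
  - apply continuity_tilt_freq_bar; auto.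
  - apply continuity_const. intros x y; reflexivity.
Qed.

(** The support of [theta s] is that of [P] for every [s], so the case distinction in [entropy]
    never switches branch and [ln] is only taken at positive values. *)
Lemma continuity_tilt_entropy : continuity (fun s => entropy N (theta s)).
Proof.
  unfold entropy. apply (continuity_opp (fun s => rsum N (fun i => rsum N (fun j =>
      if Req_EM_T (theta s i j) 0 then 0
      else theta s i j * ln (theta s i j / theta_bar N (theta s) i))))).
  apply (continuity_rsum N (fun s i => rsum N (fun j => _))). intros i Hi.
  apply (continuity_rsum N (fun s j => if Req_EM_T (theta s i j) 0 then 0
      else theta s i j * ln (theta s i j / theta_bar N (theta s) i))). intros j Hj.
  destruct (Rlt_dec 0 (P i j)) as [h|h].
  - replace (fun s => if Req_EM_T (theta s i j) 0 then 0
      else theta s i j * ln (theta s i j / theta_bar N (theta s) i)) with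
      (fun s => theta s i j * ln (theta s i j / theta_bar N (theta s) i)).
    + apply (continuity_mult (fun s => theta s i j)
        (fun s => ln (theta s i j / theta_bar N (theta s) i))).
      * apply continuity_tilt_freq; auto.
      * apply continuity_ln_pos.
        -- intros s. apply Rdiv_lt_0_compat; [apply tilt_freq_pos | apply tilt_freq_bar_pos]; auto.
        -- apply (continuity_div_pos (fun s => theta s i j) (fun s => theta_bar N (theta s) i)).
           ++ intros s. apply tilt_freq_bar_pos; auto.
           ++ apply continuity_tilt_freq; auto.
           ++ apply continuity_tilt_freq_bar; auto.
    + apply functional_extensionality; intros s. pose proof (tilt_freq_pos s i j Hi Hj h).
      destruct Req_EM_T; [lra|reflexivity].
  - replace (fun s => if Req_EM_T (theta s i j) 0 then 0
      else theta s i j * ln (theta s i j / theta_bar N (theta s) i)) with (fun _ : R => 0).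
    + apply continuity_const. intros x y; reflexivity.
    + apply functional_extensionality; intros s. rewrite tilt_freq_eq0 by auto.
      destruct Req_EM_T; [reflexivity|lra].
Qed.

(** Solve the Gibbs inequality for [- logP s] and insert it in the objective. The coefficient of the
    energy becomes [(1 - s)^2 / 2 - (1 - s) / 2 = - s (1 - s) / 2], and that of the entropy
    [(1 - s) / s]; together they are [(1 - s) / s] times the slack of the constraint. *)
Lemma tilt_freq_objective_le s : 0 < s <= 1 ->
  objective N P beta (theta s) (fun i => s * beta i * theta_bar N (theta s) i) <=
  (ln (INR N) - ln (trpow N (tilt P beta s) (S t))) / (INR (S t) * s)
  + (1 - s) * (entropy N (theta s) - s ^ 2 / 2 * energy s) / s.
Proof.
  intros Hs. rewrite tilt_freq_objective. pose proof (tilt_freq_gibbs s) as HG.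
  assert (Hn : 0 < INR (S t)) by (apply lt_0_INR; lia).
  set (n := INR (S t)) in *. set (Z := ln (trpow N (tilt P beta s) (S t))) in *.
  set (H := entropy N (theta s)) in *. set (L := logP s) in *. set (B := energy s) in *.
  apply Rmult_le_reg_r with (n * s); [apply Rmult_lt_0_compat; lra|].
  replace (((ln (INR N) - Z) / (n * s) + (1 - s) * (H - s ^ 2 / 2 * B) / s) * (n * s))
    with (ln (INR N) - Z + n * ((1 - s) * (H - s ^ 2 / 2 * B))) by (field; lra).
  nra.
Qed.
End Freq.

(* With a single state the walk has no entropy, so [xi = s beta theta_bar] is infeasible for [s > 0]
   unless [beta = 0]; [xi = 0] is then used, with a small [s]. *)
Lemma dual_bound delta : 0 < delta ->
  exists s0, 0 < s0 <= 1 /\ forall m, (2 <= m)%nat ->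
    exists s theta xi, s0 <= s <= 1 /\ feasible N P theta xi /\
      objective N P beta theta xi <=
      (ln (INR N) - ln (trpow N (tilt P beta s) (r0 * m))) / (INR (r0 * m) * s) + delta.
Proof.
  intros Hd. pose proof kappa_nonneg as Hk.
  assert (Hr : 1 <= INR r0) by (apply (le_INR 1); auto).
  destruct (le_lt_dec 2 N) as [HN2|HN1].
  - assert (HlnN : 0 < ln (INR N)).
    { rewrite <- ln_1. apply ln_increasing; [lra|]. apply (lt_INR 1). lia. }
    (* At [s0] the entropy is at least [ln N / (2 r0) - kappa s0], while the quadratic term is at
       most [kappa s0]. So [2 kappa s0 <= ln N / (2 r0)] suffices; [kappa + 1] keeps the denominator
       positive. *)
    set (a := ln (INR N) / (4 * INR r0 * (kappa + 1))).
    assert (Ha : 0 < a) by (apply Rdiv_lt_0_compat; nra).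
    exists (Rmin 1 a).
    assert (Hs0 : 0 < Rmin 1 a <= 1) by (split; [apply Rmin_pos; lra | apply Rmin_l]).
    pose proof (Rmin_r 1 a) as Hsa. set (s0 := Rmin 1 a) in *.
    split; auto. intros m Hm.
    assert (exists t, (r0 * m = S t)%nat /\ (r0 <= t)%nat) as [t [Et Ht]].
    { exists (pred (r0 * m)). split; nia. }
    set (f := fun s => entropy N (closed_walk_freq N (tilt P beta s) t) - s ^ 2 / 2 *
      rsum N (fun i => theta_bar N (closed_walk_freq N (tilt P beta s) t) i * beta i ^ 2)).
    destruct (ivt_slack f s0) as [s [Hs [Hf Hslack]]].
    + apply (continuity_minus (fun s => entropy N (closed_walk_freq N (tilt P beta s) t))).
      * apply continuity_tilt_entropy; auto.
      * apply (continuity_mult (fun s => s ^ 2 / 2)); [|apply continuity_energy; auto].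
        apply derivable_continuous. intros x. reg.
    + lra.
    + pose proof (tilt_freq_gibbs t Ht s0) as HG. rewrite <- Et in HG.
      pose proof (ln_trpow_tilt_ge s0 m ltac:(lra) ltac:(lia)) as HL.
      pose proof (tilt_freq_energy t Ht s0) as HE. pose proof (tilt_freq_logP t Ht s0) as HP0.
      unfold f.
      set (H := entropy N (closed_walk_freq N (tilt P beta s0) t)) in *.
      set (B := rsum N (fun i => theta_bar N (closed_walk_freq N (tilt P beta s0) t) i * beta i ^ 2)) in *.
      set (L := rsum N (fun i => rsum N (fun j => closed_walk_freq N (tilt P beta s0) t i j * ln (P i j)))) in *.
      rewrite mult_INR in *.
      assert (Hm' : 2 <= INR m) by (apply (le_INR 2); auto).
      set (n := INR r0 * INR m) in *.
      assert (Hn : 0 < n) by (unfold n; nra).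
      assert (H1 : s0 * L <= 0) by nra.
      assert (Hsq : s0 ^ 2 <= s0) by nra.
      assert (H2 : (s0 ^ 2 - s0) / 2 * B <= 0).
      { assert (0 <= (s0 - s0 ^ 2) * B) by (apply Rmult_le_pos; lra). lra. }
      assert (H3 : n * (H + s0 * L + (s0 ^ 2 - s0) / 2 * B) <= n * H) by (apply Rmult_le_compat_l; lra).
      assert (H4 : INR m * ln (INR N) - ln (INR N) <= n * H + kappa * s0 * n) by lra.
      (* Here [2 <= m] matters: the additive [ln N] of the Gibbs bound eats at most half of
         [m ln N]. *)
      assert (H5 : n * (ln (INR N) / (2 * INR r0)) <= INR m * ln (INR N) - ln (INR N)).
      { unfold n. replace (INR r0 * INR m * (ln (INR N) / (2 * INR r0))) with (INR m * ln (INR N) / 2) by (field; lra).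
        nra. }
      assert (H6 : ln (INR N) / (2 * INR r0) <= H + kappa * s0).
      { apply Rmult_le_reg_l with n; auto. lra. }
      assert (H7 : 2 * kappa * s0 <= ln (INR N) / (2 * INR r0)).
      { apply Rle_trans with (2 * (kappa + 1) * a).
        - apply Rmult_le_compat; lra.
        - right. unfold a. field. lra. }
      assert (s0 ^ 2 / 2 * B <= kappa * s0); [|lra].
      apply Rle_trans with (s0 * kappa); [|lra].
      apply Rmult_le_compat; nra.
    + exists s, (closed_walk_freq N (tilt P beta s) t),
        (fun i => s * beta i * theta_bar N (closed_walk_freq N (tilt P beta s) t) i).
      split; auto. split.
      * apply tilt_freq_feasible; auto. unfold f in Hf. lra.
      * eapply Rle_trans; [apply tilt_freq_objective_le; auto; lra|].
        rewrite <- Et. fold (f s). rewrite Hslack. unfold Rdiv. rewrite Rmult_0_l. lra.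
  - assert (N = 1)%nat as EN by lia.
    (* With [xi = 0] and zero entropy, the objective exceeds the Gibbs bound by at most [s0 B / 2],
       where the energy [B] is at most [kappa]. *)
    exists (Rmin 1 (delta / (kappa + 1))).
    assert (Hs0 : 0 < Rmin 1 (delta / (kappa + 1)) <= 1).
    { split; [apply Rmin_pos; [lra|apply Rdiv_lt_0_compat; lra] | apply Rmin_l]. }
    pose proof (Rmin_r 1 (delta / (kappa + 1))) as Hsa. set (s0 := Rmin _ _) in *.
    split; auto. intros m Hm.
    assert (exists t, (r0 * m = S t)%nat /\ (r0 <= t)%nat) as [t [Et Ht]].
    { exists (pred (r0 * m)). split; nia. }
    exists s0, (closed_walk_freq N (tilt P beta s0) t),
        (fun i => 0 * beta i * theta_bar N (closed_walk_freq N (tilt P beta s0) t) i).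
    assert (HH : entropy N (closed_walk_freq N (tilt P beta s0) t) = 0).
    { destruct (tilt_freq_in_Delta t Ht s0) as [_ [H1 _]].
      unfold entropy, theta_bar. rewrite EN in *. simpl in *.
      rewrite !Rplus_0_l in *. rewrite H1. destruct Req_EM_T; [lra|].
      unfold Rdiv. rewrite Rinv_1, Rmult_1_r, ln_1. ring. }
    split; [lra|]. split.
    + apply tilt_freq_feasible; auto. rewrite HH. simpl. lra.
    + rewrite tilt_freq_objective by auto. pose proof (tilt_freq_gibbs t Ht s0) as HG.
      pose proof (tilt_freq_energy t Ht s0) as HE. rewrite <- Et in HG.
      rewrite HH in *.
      set (B := rsum N (fun i => theta_bar N (closed_walk_freq N (tilt P beta s0) t) i * beta i ^ 2)) in *.
      set (L := rsum N (fun i => rsum N (fun j => closed_walk_freq N (tilt P beta s0) t i j * ln (P i j)))) in *.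
      assert (Hn : 0 < INR (r0 * m)) by (apply lt_0_INR; nia).
      set (n := INR (r0 * m)) in *. set (Z := ln (trpow _ _ _)) in *.
      assert (HsB : s0 * B <= delta).
      { apply Rle_trans with (delta / (kappa + 1) * (kappa + 1)).
        - apply Rmult_le_compat; lra.
        - right; field; lra. }
      assert (- L + (1 - s0) / 2 * B <= (ln (INR N) - Z) / (n * s0)); [|lra].
      apply Rmult_le_reg_r with (n * s0); [nra|].
      replace ((ln (INR N) - Z) / (n * s0) * (n * s0)) with (ln (INR N) - Z) by (field; lra).
      nra.
Qed.
End Tilt.

(** * Sums over paths *)

Definition lsum {A : Type} (f : A -> R) (l : list A) : R := fold_right Rplus 0 (map f l).

Lemma lsum_cons A (f : A -> R) a l : lsum f (a :: l) = f a + lsum f l.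
Proof. reflexivity. Qed.

Lemma lsum_app A (f : A -> R) l1 l2 : lsum f (l1 ++ l2) = lsum f l1 + lsum f l2.
Proof. unfold lsum. induction l1; simpl; [ring|]. rewrite IHl1. ring. Qed.

Lemma lsum_map A B (g : A -> B) (f : B -> R) l : lsum f (map g l) = lsum (fun a => f (g a)) l.
Proof. unfold lsum. rewrite map_map. reflexivity. Qed.

Lemma lsum_flat_map A B (g : A -> list B) (f : B -> R) l :
  lsum f (flat_map g l) = lsum (fun a => lsum f (g a)) l.
Proof. induction l; simpl; [reflexivity|]. rewrite lsum_app, IHl. reflexivity. Qed.

Lemma lsum_le A (f g : A -> R) l : (forall a, In a l -> f a <= g a) -> lsum f l <= lsum g l.
Proof.
  unfold lsum. induction l; simpl; intros H; [lra|].
  apply Rplus_le_compat; [apply H; auto | apply IHl; auto].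
Qed.

Lemma lsum_ext A (f g : A -> R) l : (forall a, In a l -> f a = g a) -> lsum f l = lsum g l.
Proof. intros H. apply Rle_antisym; apply lsum_le; intros; rewrite H; auto; lra. Qed.

Lemma lsum_scal A c (f : A -> R) l : lsum (fun a => c * f a) l = c * lsum f l.
Proof. induction l; [unfold lsum; simpl; ring|]. rewrite !lsum_cons, IHl. ring. Qed.

Lemma lsum_nonneg A (f : A -> R) l : (forall a, In a l -> 0 <= f a) -> 0 <= lsum f l.
Proof.
  intros H. unfold lsum. induction l; simpl; [lra|].
  apply Rplus_le_le_0_compat; [apply H; simpl; auto | apply IHl; intros; apply H; simpl; auto].
Qed.

Lemma lsum_ge_term A (f : A -> R) l a :
  (forall a, In a l -> 0 <= f a) -> In a l -> f a <= lsum f l.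
Proof.
  induction l as [|b l IH]; intros H Ha; [destruct Ha|]. rewrite lsum_cons.
  assert (0 <= lsum f l) by (apply lsum_nonneg; intros; apply H; simpl; auto).
  assert (0 <= f b) by (apply H; simpl; auto).
  destruct Ha as [->|Ha]; [lra|].
  assert (f a <= lsum f l) by (apply IH; auto; intros; apply H; simpl; auto). lra.
Qed.

Lemma lsum_seq n f : lsum f (seq 0 n) = rsum n f.
Proof.
  induction n; [reflexivity|]. rewrite seq_S, lsum_app, IHn. unfold lsum. simpl. ring.
Qed.

Lemma paths_spec N t s : In s (paths N t) -> length s = t /\ Forall (fun a => (a < N)%nat) s.
Proof.
  revert s. induction t; simpl; intros s Hs.
  - destruct Hs as [<-|[]]. auto.
  - apply in_flat_map in Hs as [r [Hr Hs]]. apply in_map_iff in Hs as [i [<- Hi]].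
    destruct (IHt r Hr) as [H1 H2]. apply in_seq in Hi. split.
    + rewrite length_app, H1. simpl. lia.
    + apply Forall_app. split; auto. constructor; [lia | auto].
Qed.

Lemma path_prob_snoc u M s i : s <> [] -> path_prob u M (s ++ [i]) = path_prob u M s * M (last s O) i.
Proof.
  destruct s as [|a r]; [congruence|]. intros _. simpl path_prob.
  rewrite Rmult_assoc. f_equal. revert a. induction r as [|b r IH]; intros a.
  - simpl. ring.
  - change (M a b * chain_prob M b (r ++ [i]) = M a b * chain_prob M b r * M (last (b :: r) O) i).
    rewrite IH. ring.
Qed.

(** The test function of the last state is the strengthening that the induction needs: [paths] grows
    at its end, and summing out the new state replaces [f] by [M f]. *)
Lemma paths_sum_last N u M t f :
  lsum (fun s => path_prob u M s * f (last s O)) (paths N (S t)) =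
  rsum N (fun j => rsum N (fun i => u i * mpow N M t i j) * f j).
Proof.
  revert f. induction t; intros f.
  - simpl paths. rewrite app_nil_r, lsum_map, lsum_seq. apply rsum_ext; intros j Hj.
    simpl. rewrite (rsum_ext N _ (fun l => (if Nat.eq_dec j l then 1 else 0) * u l)).
    + rewrite rsum_delta by auto. ring.
    + intros l Hl. destruct (Nat.eq_dec l j), (Nat.eq_dec j l); subst; try congruence; ring.
  - change (paths N (S (S t))) with
      (flat_map (fun s => map (fun i => s ++ [i]) (seq 0 N)) (paths N (S t))).
    rewrite lsum_flat_map.
    rewrite (lsum_ext _ _ (fun s => path_prob u M s * rsum N (fun j => M (last s O) j * f j))).
    + rewrite (IHt (fun l => rsum N (fun j => M l j * f j))).
      rewrite (rsum_ext N _ (fun l => rsum N (fun j => rsum N (fun i => u i * mpow N M t i l) * M l j * f j))).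
      2:{ intros. rewrite <- rsum_scal_l. apply rsum_ext; intros; ring. }
      rewrite rsum_swap. apply rsum_ext; intros j Hj. rewrite rsum_scal_r. f_equal.
      rewrite (rsum_ext N _ (fun l => rsum N (fun i => u i * (mpow N M t i l * M l j)))).
      2:{ intros. rewrite <- rsum_scal_r. apply rsum_ext; intros; ring. }
      rewrite rsum_swap. apply rsum_ext; intros i Hi. rewrite rsum_scal_l. reflexivity.
    + intros s Hs. rewrite lsum_map, lsum_seq, <- rsum_scal_l. apply rsum_ext; intros j Hj.
      assert (s <> []) by (apply paths_spec in Hs as [Hs _]; destruct s; [discriminate|congruence]).
      rewrite path_prob_snoc, last_last by auto. ring.
Qed.

Lemma paths_sum N u M t :
  lsum (path_prob u M) (paths N (S t)) =
  rsum N (fun i => u i * rsum N (fun j => mpow N M t i j)).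
Proof.
  rewrite (lsum_ext _ _ (fun s => path_prob u M s * (fun _ => 1) (last s O))) by (intros; ring).
  rewrite (paths_sum_last N u M t (fun _ => 1)).
  rewrite (rsum_ext N _ (fun j => rsum N (fun i => u i * mpow N M t i j))) by (intros; ring).
  rewrite rsum_swap. apply rsum_ext; intros. apply rsum_scal_l.
Qed.

(** [tilt] charges [beta a ^ 2] to the step that leaves [a], so the last state of the path is not
    charged on the right, nor is [pi]. Both missing factors are at most 1, whence an inequality. *)
Lemma path_prob_tilt N P pi beta sigma s : (forall i j, (i < N)%nat -> (j < N)%nat -> 0 <= P i j) ->
  (forall i, (i < N)%nat -> 0 < pi i <= 1) -> 0 <= sigma <= 1 ->
  Forall (fun a => (a < N)%nat) s -> 0 < path_prob pi P s ->
  exp (sigma * ln (path_prob pi P s) + lsum (fun a => (sigma ^ 2 - sigma) * beta a ^ 2 / 2) s)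
  <= path_prob (fun _ => 1) (tilt P beta sigma) s.
Proof.
  intros HP Hpi Hs HF Hp. assert (Hsq : 0 <= sigma - sigma ^ 2) by nra. destruct s as [|a r].
  - simpl. rewrite ln_1. unfold lsum; simpl. rewrite Rmult_0_r, Rplus_0_l, exp_0. lra.
  - simpl path_prob in *. rewrite Rmult_1_l. inversion HF as [|? ? Ha HF']; subst. clear HF.
    pose proof (Hpi a Ha) as Hpa.
    assert (Hc : 0 < chain_prob P a r) by (apply Rmult_lt_reg_l with (pi a); lra). clear Hp.
    rewrite ln_mult by lra.
    assert (Hlp : sigma * ln (pi a) <= 0).
    { assert (ln (pi a) <= 0) by (apply ln_le_exp; [lra | rewrite exp_0; lra]). nra. }
    apply Rle_trans with (exp (sigma * ln (chain_prob P a r) +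
      lsum (fun a => (sigma ^ 2 - sigma) * beta a ^ 2 / 2) (a :: r))); [apply exp_le_compat; lra|].
    clear Hlp Hpa Hpi. revert a Ha Hc. induction r as [|b r IH]; intros a Ha Hc.
    + simpl chain_prob. rewrite ln_1, <- exp_0, lsum_cons. apply exp_le_compat. change (lsum _ []) with 0.
      assert (0 <= (sigma - sigma ^ 2) * beta a ^ 2) by (apply Rmult_le_pos; [lra | apply pow2_ge_0]). lra.
    + inversion HF' as [|? ? Hb HF'']; subst. simpl in Hc.
      assert (Hab : 0 < P a b).
      { destruct (Rle_lt_or_eq_dec _ _ (HP a b Ha Hb)) as [h|h]; auto. rewrite <- h in Hc. lra. }
      assert (Hcr : 0 < chain_prob P b r) by nra.
      simpl chain_prob. rewrite lsum_cons, ln_mult by auto.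
      specialize (IH HF'' b Hb Hcr).
      replace (tilt P beta sigma a b) with (exp (sigma * ln (P a b) + (sigma ^ 2 - sigma) * beta a ^ 2 / 2))
        by (unfold tilt; destruct Rlt_dec; [reflexivity|lra]).
      eapply Rle_trans; [|apply Rmult_le_compat_l; [left; apply exp_pos | apply IH]].
      rewrite <- exp_plus. right. f_equal. ring.
Qed.

(** * Probability spaces *)

Lemma pred_ext A (P Q : A -> Prop) : (forall w, P w <-> Q w) -> P = Q.
Proof. intros H. apply functional_extensionality; intros w. apply propositional_extensionality; auto. Qed.

Section Prob.
Variables (Omega : Type) (F : (Omega -> Prop) -> Prop) (Pr : (Omega -> Prop) -> R).
Hypothesis HPr : prob_space Omega F Pr.

Lemma F_True : F (fun _ => True).
Proof. apply HPr. Qed.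

Lemma F_not A : F A -> F (fun w => ~ A w).
Proof. apply HPr. Qed.

Lemma F_ex (A : nat -> Omega -> Prop) : (forall n, F (A n)) -> F (fun w => exists n, A n w).
Proof. apply HPr. Qed.

Lemma F_False : F (fun _ => False).
Proof.
  rewrite (pred_ext Omega _ (fun w => ~ True)) by tauto. apply F_not, F_True.
Qed.

Lemma F_or A B : F A -> F B -> F (fun w => A w \/ B w).
Proof.
  intros HA HB.
  rewrite (pred_ext Omega _ (fun w => exists n, (match n with O => A | _ => B end) w)).
  - apply F_ex. intros [|n]; auto.
  - intros w. split.
    + intros [H|H]; [exists O | exists 1%nat]; auto.
    + intros [[|n] H]; auto.
Qed.

Lemma F_and A B : F A -> F B -> F (fun w => A w /\ B w).
Proof.
  intros HA HB. rewrite (pred_ext Omega _ (fun w => ~ (~ A w \/ ~ B w))).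
  - apply F_not, F_or; apply F_not; auto.
  - intros w. destruct (classic (A w)), (classic (B w)); tauto.
Qed.

Lemma Pr_nonneg A : F A -> 0 <= Pr A.
Proof. apply HPr. Qed.

(** Additivity is given for infinite sequences only, so this comes first: for the constant sequence
    of empty events the partial sums [(n + 1) x] must converge to [x]. *)
Lemma Pr_False : Pr (fun _ => False) = 0.
Proof.
  destruct HPr as [_ [_ [_ [_ [_ Hs]]]]].
  specialize (Hs (fun _ _ => False) (fun _ => F_False) ltac:(tauto)).
  cbv beta in Hs. rewrite (pred_ext Omega (fun w => exists _ : nat, False) (fun _ => False)) in Hs.
  2:{ intros w; split; [intros [_ []] | tauto]. }
  pose proof (Pr_nonneg _ F_False) as H0. set (x := Pr (fun _ => False)) in *.
  destruct (Rle_lt_or_eq_dec _ _ H0) as [h|h]; auto. exfalso.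
  destruct (Hs x h) as [n0 Hn]. specialize (Hn (S (S n0)) ltac:(lia)).
  assert (E : forall n, sum_f_R0 (fun _ => x) n = INR (S n) * x).
  { induction n; [simpl; ring|]. rewrite tech5, IHn, (S_INR (S n)). ring. }
  rewrite E in Hn. unfold Rdist in Hn.
  rewrite !S_INR in Hn. pose proof (pos_INR n0).
  rewrite Rabs_right in Hn; nra.
Qed.

Lemma Pr_disjoint A B : F A -> F B -> (forall w, A w -> B w -> False) ->
  Pr (fun w => A w \/ B w) = Pr A + Pr B.
Proof.
  intros HA HB Hd. destruct HPr as [_ [_ [_ [_ [_ Hs]]]]].
  set (C := fun n : nat => match n with O => A | 1%nat => B | _ => fun _ => False end).
  specialize (Hs C).
  rewrite (pred_ext Omega (fun w => A w \/ B w) (fun w => exists n, C n w)).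
  2:{ intros w. split.
      - intros [H|H]; [exists O | exists 1%nat]; auto.
      - intros [[|[|n]] H]; simpl in H; tauto. }
  apply (uniqueness_sum (fun n => Pr (C n))).
  - apply Hs.
    + intros [|[|n]]; simpl; auto using F_False.
    + intros [|[|n]] [|[|m]] w; simpl; try tauto; try lia; intros _ h1 h2; eauto.
  - intros eps Heps. exists 1%nat. intros n Hn.
    assert (E : sum_f_R0 (fun n => Pr (C n)) n = Pr A + Pr B).
    { destruct n as [|n]; [lia|]. clear Hn. induction n; [reflexivity|].
      rewrite tech5, IHn. simpl. rewrite Pr_False. ring. }
    rewrite E, Rdist_eq. auto.
Qed.

Lemma Pr_split A B : F A -> F B ->
  Pr A = Pr (fun w => A w /\ B w) + Pr (fun w => A w /\ ~ B w).
Proof.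
  intros HA HB. rewrite <- Pr_disjoint; auto using F_and, F_not.
  - f_equal. apply pred_ext; intros w. destruct (classic (B w)); tauto.
  - tauto.
Qed.

Lemma Pr_mono A B : F A -> F B -> (forall w, A w -> B w) -> Pr A <= Pr B.
Proof.
  intros HA HB H. rewrite (Pr_split B A HB HA).
  rewrite (pred_ext Omega (fun w => B w /\ A w) A) by (intros w; split; [tauto|auto]).
  pose proof (Pr_nonneg _ (F_and _ _ HB (F_not _ HA))). lra.
Qed.

Lemma Pr_le_1 A : F A -> Pr A <= 1.
Proof.
  intros HA. replace 1 with (Pr (fun _ => True)) by apply HPr. apply Pr_mono; auto using F_True.
Qed.

Lemma Pr_not A : F A -> Pr (fun w => ~ A w) = 1 - Pr A.
Proof.
  intros HA. replace 1 with (Pr (fun _ => True)) by apply HPr.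
  rewrite (Pr_split (fun _ => True) A F_True HA).
  rewrite (pred_ext Omega (fun w => True /\ A w) A), (pred_ext Omega (fun w => True /\ ~ A w) (fun w => ~ A w)); try tauto.
  ring.
Qed.

Lemma Pr_or_le A B : F A -> F B -> Pr (fun w => A w \/ B w) <= Pr A + Pr B.
Proof.
  intros HA HB. rewrite (pred_ext Omega _ (fun w => A w \/ (B w /\ ~ A w))).
  - rewrite Pr_disjoint; auto using F_and, F_not; [|tauto].
    apply Rplus_le_compat_l, Pr_mono; auto using F_and, F_not. tauto.
  - intros w. destruct (classic (A w)); tauto.
Qed.

Lemma F_all_lt (A : nat -> Omega -> Prop) n :
  (forall m, F (A m)) -> F (fun w => forall m, (m < n)%nat -> A m w).
Proof.
  intros HA. induction n.
  - rewrite (pred_ext Omega _ (fun _ => True)); [apply F_True|]. intros; split; auto; intros; lia.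
  - rewrite (pred_ext Omega _ (fun w => (forall m, (m < n)%nat -> A m w) /\ A n w)); [apply F_and; auto|].
    intros w. split.
    + intros H. split; [intros; apply H; lia | apply H; lia].
    + intros [H1 H2] m Hm. destruct (Nat.eq_dec m n) as [->|]; auto. apply H1; lia.
Qed.

Lemma sum_f_R0_half n : sum_f_R0 (fun n => (/ 2) ^ (n + 2)) n <= / 2.
Proof.
  assert (E : sum_f_R0 (fun n => (/ 2) ^ (n + 2)) n = / 2 - (/ 2) ^ (n + 2)).
  { induction n; [simpl; field|]. rewrite tech5, IHn. simpl. field. }
  rewrite E. pose proof (pow_lt (/2) (n+2) ltac:(lra)). lra.
Qed.

Lemma Pr_ex_le_half (A : nat -> Omega -> Prop) :
  (forall n, F (A n)) -> (forall n, Pr (A n) <= (/ 2) ^ (n + 2)) ->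
  Pr (fun w => exists n, A n w) <= / 2.
Proof.
  intros HA Hle.
  set (B := fun n w => A n w /\ forall m, (m < n)%nat -> ~ A m w).
  assert (HB : forall n, F (B n)).
  { intros n. apply F_and; auto. apply (F_all_lt (fun m w => ~ A m w)). intros; apply F_not; auto. }
  rewrite (pred_ext Omega _ (fun w => exists n, B n w)).
  - destruct HPr as [_ [_ [_ [_ [_ Hs]]]]].
    assert (Hsum := Hs B HB). clear Hs.
    specialize (Hsum ltac:(intros n m w Hnm [h1 h2] [h3 h4];
      destruct (Nat.lt_total n m) as [h|[h|h]]; [exact (h4 n h h1) | destruct (Hnm h) | exact (h2 m h h3)])).
    apply Rnot_lt_le. intros Hlt.
    destruct (Hsum (Pr (fun w => exists n, B n w) - / 2) ltac:(lra)) as [n0 Hn].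
    specialize (Hn n0 (le_n _)). unfold Rdist in Hn.
    assert (sum_f_R0 (fun n => Pr (B n)) n0 <= / 2).
    { eapply Rle_trans; [|apply (sum_f_R0_half n0)]. apply sum_Rle. intros n _.
      eapply Rle_trans; [|apply Hle]. apply Pr_mono; auto. unfold B; tauto. }
    rewrite Rabs_left in Hn; lra.
  - intros w. split; [|intros [n [h _]]; eauto].
    intros H. destruct (dec_inh_nat_subset_has_unique_least_element (fun n => A n w)) as [n [[Hn Hmin] _]]; auto.
    { intros n. apply classic. }
    exists n. split; auto. intros m Hm Hm'. specialize (Hmin m Hm'). lia.
Qed.

(** [std_normal_cdf] prescribes the limit at minus infinity only. The upper tail vanishes because
    [Y] has finite values: the events [D n], on which [n] is the least natural number above [Y],
    partition the space, and their partial sums are the values of the distribution function. *)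
Lemma Pr_upper_tail (Y : Omega -> R) eta : (forall a, F (fun w => Y w <= a)) -> 0 < eta ->
  exists M, Pr (fun w => ~ Y w <= M) < eta.
Proof.
  intros HY Heta.
  set (D := fun n w => match n with O => Y w <= 0 | S m => Y w <= INR n /\ ~ Y w <= INR m end).
  assert (HD : forall n, F (D n)) by
    (intros [|n]; [apply HY | apply F_and; [apply HY | apply (F_not (fun w => Y w <= INR n)), HY]]).
  destruct HPr as [_ [_ [_ [_ [H1 Hs]]]]].
  assert (Hsum := Hs D HD). clear Hs.
  assert (Hle : forall n w, D n w -> Y w <= INR n).
  { intros [|n] w h; simpl in *; tauto. }
  assert (Hgt : forall n m w, (n < m)%nat -> D m w -> ~ Y w <= INR n).
  { intros n [|m] w Hn h; [lia|]. destruct h as [_ h]. intros h'. apply h.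
    apply Rle_trans with (INR n); auto. apply le_INR. lia. }
  specialize (Hsum ltac:(intros n m w Hnm h1 h2;
     destruct (Nat.lt_total n m) as [h|[h|h]];
       [exact (Hgt n m w h h2 (Hle n w h1)) | destruct (Hnm h) | exact (Hgt m n w h h1 (Hle m w h2))])).
  rewrite (pred_ext Omega (fun w => exists n, D n w) (fun _ => True)), H1 in Hsum.
  2:{ intros w. split; auto. intros _.
      destruct (dec_inh_nat_subset_has_unique_least_element (fun n => Y w <= INR n)) as [n [[Hn Hmin] _]].
      - intros n. apply classic.
      - destruct (INR_unbounded (Y w)) as [n Hn]. exists n. lra.
      - exists n. destruct n as [|n]; simpl; auto. split; auto.
        intros h. specialize (Hmin n h). lia. }
  assert (E : forall n, sum_f_R0 (fun n => Pr (D n)) n = Pr (fun w => Y w <= INR n)).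
  { induction n; [reflexivity|].
    rewrite tech5, IHn, <- Pr_disjoint; auto.
    - f_equal. apply pred_ext; intros w. split.
      + intros [h|h]; [|apply Hle; auto]. apply Rle_trans with (INR n); auto. apply le_INR; lia.
      + intros h. destruct (classic (Y w <= INR n)); [auto|right; split; auto].
    - intros w h1 h2. exact (Hgt n (S n) w ltac:(lia) h2 h1). }
  destruct (Hsum eta Heta) as [n0 Hn]. specialize (Hn n0 (le_n _)).
  exists (INR n0). rewrite Pr_not by auto. rewrite E in Hn. unfold Rdist in Hn.
  apply Rabs_def2 in Hn. lra.
Qed.

Lemma F_Exists A (Q : A -> Omega -> Prop) l :
  (forall a, In a l -> F (Q a)) -> F (fun w => Exists (fun a => Q a w) l).
Proof.
  induction l as [|a l IH]; intros H.
  - rewrite (pred_ext Omega _ (fun _ => False)); [apply F_False|]. intros; apply Exists_nil.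
  - rewrite (pred_ext Omega _ (fun w => Q a w \/ Exists (fun a => Q a w) l)).
    + apply F_or; [apply H; simpl; auto | apply IH; intros; apply H; simpl; auto].
    + intros w. apply Exists_cons.
Qed.

Lemma Pr_Exists_le A (Q : A -> Omega -> Prop) l c : (forall a, In a l -> F (Q a)) ->
  (forall a, In a l -> Pr (Q a) <= c) -> Pr (fun w => Exists (fun a => Q a w) l) <= INR (length l) * c.
Proof.
  induction l as [|a l IH]; intros HF Hc.
  - rewrite (pred_ext Omega _ (fun _ => False)); [rewrite Pr_False; simpl; lra|]. intros; apply Exists_nil.
  - rewrite (pred_ext Omega _ (fun w => Q a w \/ Exists (fun a => Q a w) l)) by (intros; apply Exists_cons).
    eapply Rle_trans; [apply Pr_or_le|].
    + apply HF; simpl; auto.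
    + apply F_Exists. intros; apply HF; simpl; auto.
    + simpl length. rewrite S_INR.
      assert (Pr (Q a) <= c) by (apply Hc; simpl; auto).
      assert (Pr (fun w => Exists (fun a => Q a w) l) <= INR (length l) * c).
      { apply IH; intros; [apply HF | apply Hc]; simpl; auto. }
      lra.
Qed.

(* A simple function [sum c 1_A] is encoded by the list of its pairs [(c, A)]. *)
Definition simple_val (g : list (R * (Omega -> Prop))) (w : Omega) : R :=
  lsum (fun p => fst p * if excluded_middle_informative (snd p w) then 1 else 0) g.

Lemma F_simple_ge g K : (forall p, In p g -> F (snd p)) -> F (fun w => K <= simple_val g w).
Proof.
  revert K. induction g as [|[c A] g IH]; intros K HF.
  - destruct (Rle_dec K 0) as [h|h].
    + rewrite (pred_ext Omega _ (fun _ => True)); [apply F_True|]. intros; unfold simple_val, lsum; simpl; tauto.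
    + rewrite (pred_ext Omega _ (fun _ => False)); [apply F_False|]. intros; unfold simple_val, lsum; simpl; tauto.
  - assert (HA : F A) by (apply (HF (c, A)); simpl; auto).
    assert (HG : forall K, F (fun w => K <= simple_val g w)) by (intros; apply IH; intros; apply HF; simpl; auto).
    rewrite (pred_ext Omega _ (fun w => (A w /\ K - c <= simple_val g w) \/ (~ A w /\ K <= simple_val g w))).
    + auto using F_or, F_and, F_not.
    + intros w. unfold simple_val. rewrite lsum_cons. simpl.
      destruct excluded_middle_informative as [h|h]; split; intros H.
      * left. split; auto. lra.
      * destruct H as [[_ H]|[h' _]]; [lra|tauto].
      * right. split; auto. lra.
      * destruct H as [[h' _]|[_ H]]; [tauto|lra].
Qed.

(** A lower bound for the integral of a simple function over [B]. Quantifying over [B] and [K]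
    replaces linearity of the integral: the first pair [(c, A)] splits [B] along [A], and the
    threshold drops to [K - c] on the part inside [A]. *)
Lemma simple_lower_bound g K B : (forall p, In p g -> F (snd p)) -> F B ->
  (forall w, B w -> K <= simple_val g w) ->
  K * Pr B <= lsum (fun p => fst p * Pr (fun w => B w /\ snd p w)) g.
Proof.
  revert K B. induction g as [|[c A] g IH]; intros K B HF HB H.
  - unfold simple_val, lsum in *; simpl in *. destruct (classic (exists w, B w)) as [[w hw]|h].
    + specialize (H w hw). pose proof (Pr_nonneg B HB). nra.
    + rewrite (pred_ext Omega B (fun _ => False)); [rewrite Pr_False; lra|].
      intros w; split; [intros; apply h; eauto | tauto].
  - assert (HA : F A) by (apply (HF (c, A)); simpl; auto).
    assert (HF' : forall p, In p g -> F (snd p)) by (intros; apply HF; simpl; auto).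
    assert (H1 := IH (K - c) (fun w => B w /\ A w) HF' (F_and _ _ HB HA)).
    assert (H2 := IH K (fun w => B w /\ ~ A w) HF' (F_and _ _ HB (F_not _ HA))).
    rewrite lsum_cons. simpl.
    rewrite (lsum_ext _ _ (fun p => fst p * Pr (fun w => (B w /\ A w) /\ snd p w)
                                  + fst p * Pr (fun w => (B w /\ ~ A w) /\ snd p w))).
    + assert (E : forall (f1 f2 : R * (Omega -> Prop) -> R) l, lsum (fun p => f1 p + f2 p) l = lsum f1 l + lsum f2 l).
      { intros f1 f2 l. induction l; [unfold lsum; simpl; ring|]. rewrite !lsum_cons, IHl. ring. }
      rewrite E. clear E. rewrite (Pr_split B A HB HA).
      lapply H1; [clear H1; intros H1|]. lapply H2; [clear H2; intros H2|]. lra.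
      * intros w [h1 h2]. specialize (H w h1). unfold simple_val in H. rewrite lsum_cons in H. simpl in H.
        destruct excluded_middle_informative; [tauto|]. unfold simple_val; lra.
      * intros w [h1 h2]. specialize (H w h1). unfold simple_val in H. rewrite lsum_cons in H. simpl in H.
        destruct excluded_middle_informative; [|tauto]. unfold simple_val; lra.
    + intros p Hp. rewrite <- Rmult_plus_distr_l. f_equal.
      rewrite (Pr_split (fun w => B w /\ snd p w) A); auto using F_and.
      f_equal; f_equal; apply pred_ext; intros; tauto.
Qed.

Lemma simple_markov g K : 0 < K -> (forall p, In p g -> 0 <= fst p /\ F (snd p)) ->
  Pr (fun w => K <= simple_val g w) <= lsum (fun p => fst p * Pr (snd p)) g / K.
Proof.
  intros HK Hg.
  assert (HF : forall p, In p g -> F (snd p)) by (intros; apply Hg; auto).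
  pose proof (F_simple_ge g K HF) as HB.
  pose proof (simple_lower_bound g K _ HF HB (fun w h => h)) as H.
  apply Rmult_le_reg_l with K; auto.
  replace (K * (lsum (fun p => fst p * Pr (snd p)) g / K)) with (lsum (fun p => fst p * Pr (snd p)) g) by (field; lra).
  eapply Rle_trans; [apply H|]. apply lsum_le; intros p Hp.
  apply Rmult_le_compat_l; [apply Hg; auto|]. apply Pr_mono; auto using F_and. tauto.
Qed.
End Prob.

(** * Gaussian moments on a grid *)

Section Gaussian.
Variables (N : nat) (Omega : Type) (F : (Omega -> Prop) -> Prop) (Pr : (Omega -> Prop) -> R)
  (Phi : R -> R) (X : nat -> nat -> Omega -> R).
Hypothesis HN : (0 < N)%nat.
Hypothesis HPr : prob_space Omega F Pr.
Hypothesis HPhi : std_normal_cdf Phi.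
Hypothesis HX : iid_std_gaussian N Omega F Pr Phi X.

Definition valid (v : nat * nat) : Prop := (fst v < N)%nat /\ (1 <= snd v)%nat.

Lemma F_le v a : valid v -> F (fun w => X (fst v) (snd v) w <= a).
Proof. intros [h1 h2]. apply HX; auto. Qed.

Lemma Pr_le_Phi v a : valid v -> Pr (fun w => X (fst v) (snd v) w <= a) = Phi a.
Proof.
  intros [h1 h2]. destruct HX as [_ H]. specialize (H [(v, a)]). simpl in H.
  rewrite Rmult_1_r in H. rewrite <- H.
  - f_equal. apply pred_ext; intros w. rewrite Forall_cons_iff. simpl. intuition.
  - constructor; [auto|constructor].
  - repeat constructor; auto.
Qed.

Lemma Phi_bounds a : 0 <= Phi a <= 1.
Proof.
  assert (Hv : valid (O, 1%nat)) by (split; simpl; lia).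
  rewrite <- (Pr_le_Phi (O, 1%nat)) by auto. split.
  - eapply Pr_nonneg; eauto. apply F_le; auto.
  - eapply Pr_le_1; eauto. apply F_le; auto.
Qed.

Definition in_cell (p : (nat * nat) * (R * R)) (w : Omega) : Prop :=
  ~ X (fst (fst p)) (snd (fst p)) w <= fst (snd p) /\ X (fst (fst p)) (snd (fst p)) w <= snd (snd p).

Definition in_box (l : list ((nat * nat) * (R * R))) (w : Omega) : Prop :=
  Forall (fun p => in_cell p w) l.

Definition box_weight (l : list ((nat * nat) * (R * R))) : R :=
  fold_right Rmult 1 (map (fun p => Phi (snd (snd p)) - Phi (fst (snd p))) l).

Lemma F_Forall A (Q : A -> Omega -> Prop) l :
  Forall (fun a => F (Q a)) l -> F (fun w => Forall (fun a => Q a w) l).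
Proof.
  induction l as [|a l IH]; intros H.
  - rewrite (pred_ext Omega _ (fun _ => True)); [apply HPr|]. intros; split; auto.
  - inversion H; subst.
    rewrite (pred_ext Omega _ (fun w => Q a w /\ Forall (fun a => Q a w) l)).
    + eapply F_and; eauto.
    + intros w. apply Forall_cons_iff.
Qed.

Lemma F_box l : Forall (fun p => valid (fst p)) l -> F (in_box l).
Proof.
  intros H. apply F_Forall. eapply Forall_impl; [|apply H].
  intros p Hp. apply (F_and _ _ _ HPr); [|apply F_le; auto].
  apply (F_not _ _ _ HPr (fun w => X (fst (fst p)) (snd (fst p)) w <= fst (snd p))), F_le; auto.
Qed.

(** Independence is given for joint distribution functions only. Cells are converted one at a time
    by subtracting the event below [a] from the event below [b]; the list [l'] holds the coordinates
    turned into such events. *)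
Lemma Pr_box_and_le l : forall l' : list ((nat * nat) * R),
  Forall (fun p => valid (fst p) /\ fst (snd p) <= snd (snd p)) l ->
  Forall (fun p => valid (fst p)) l' -> NoDup (map fst l ++ map fst l') ->
  Pr (fun w => in_box l w /\ Forall (fun p => X (fst (fst p)) (snd (fst p)) w <= snd p) l') =
  box_weight l * fold_right Rmult 1 (map (fun p => Phi (snd p)) l').
Proof.
  induction l as [|[v [a b]] l IH]; intros l' Hl Hl' Hnd.
  - unfold box_weight. simpl. rewrite Rmult_1_l. destruct HX as [_ H]. rewrite <- H; auto.
    f_equal. apply pred_ext; intros w. split; [tauto|]. intros h; split; auto. constructor.
  - inversion Hl as [|? ? [Hv Hab] Hl2]; subst. simpl in Hv, Hab.
    assert (Hnd' : forall c, NoDup (map fst l ++ map fst ((v, c) :: l'))).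
    { intros c. eapply Permutation_NoDup; [|apply Hnd]. simpl. apply Permutation_middle. }
    assert (Hb := IH ((v, b) :: l') Hl2 ltac:(constructor; auto) (Hnd' b)).
    assert (Ha := IH ((v, a) :: l') Hl2 ltac:(constructor; auto) (Hnd' a)).
    assert (HFl : F (in_box l)).
    { apply F_box. eapply Forall_impl; [|apply Hl2]. simpl; tauto. }
    assert (HFl' : forall l' : list ((nat * nat) * R), Forall (fun p => valid (fst p)) l' ->
       F (fun w => Forall (fun p => X (fst (fst p)) (snd (fst p)) w <= snd p) l')).
    { intros l0 H0. apply (F_Forall _ (fun p w => X (fst (fst p)) (snd (fst p)) w <= snd p)).
      eapply Forall_impl; [|apply H0]. intros p Hp. apply F_le; auto. }
    rewrite (Pr_split _ _ _ HPr _ (fun w => X (fst v) (snd v) w <= a)) in Hb.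
    + rewrite (pred_ext Omega (fun w => (_ /\ _) /\ X (fst v) (snd v) w <= a)
        (fun w => in_box l w /\ Forall (fun p => X (fst (fst p)) (snd (fst p)) w <= snd p) ((v, a) :: l'))) in Hb.
      * rewrite Ha in Hb.
        rewrite (pred_ext Omega _ (fun w => (in_box l w /\ Forall (fun p => X (fst (fst p)) (snd (fst p)) w <= snd p) ((v, b) :: l'))
           /\ ~ X (fst v) (snd v) w <= a)).
        -- unfold box_weight in *. simpl in *. lra.
        -- intros w. unfold in_box. rewrite !Forall_cons_iff. unfold in_cell. simpl. tauto.
      * intros w. rewrite !Forall_cons_iff. simpl. split; [tauto|]. intros [h1 [h2 h3]].
        repeat split; auto. lra.
    + apply (F_and _ _ _ HPr); auto.
    + apply F_le; auto.
Qed.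

Lemma Pr_box l : Forall (fun p => valid (fst p) /\ fst (snd p) <= snd (snd p)) l ->
  NoDup (map fst l) -> Pr (in_box l) = box_weight l.
Proof.
  intros Hl Hnd.
  assert (H := Pr_box_and_le l [] Hl ltac:(constructor) ltac:(rewrite app_nil_r; auto)).
  simpl in H. rewrite Rmult_1_r in H. rewrite <- H.
  f_equal. apply pred_ext; intros w. split; [intros h; split; auto | tauto].
Qed.

(* [exp (c^2/2) Phi (x - c)] has derivative [exp (c x) Phi' x], so it plays the role of the
   incomplete exponential moment of the Gaussian. *)
Lemma exp_moment_cell c a h : 0 < h ->
  exp (c * a) * (Phi (a + h) - Phi a) <=
  exp (Rabs c * h + c ^ 2 / 2) * (Phi (a + h - c) - Phi (a - c)).
Proof.
  intros Hh. set (C := exp (Rabs c * h + c ^ 2 / 2)). set (D := exp (c * a)).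
  set (phi := fun x => exp (- (x ^ 2) / 2) / sqrt (2 * PI)).
  assert (Hd : forall x, derivable_pt_lim (fun x => C * Phi (x - c) - D * Phi x) x (C * phi (x - c) - D * phi x)).
  { intros x. apply (derivable_pt_lim_minus (fun x => C * Phi (x - c)) (fun x => D * Phi x)).
    - apply (derivable_pt_lim_scal (fun x => Phi (x - c))).
      replace (phi (x - c)) with (phi (x - c) * (1 - 0)) by ring.
      apply (derivable_pt_lim_comp (fun x => x - c) Phi); [|apply HPhi].
      apply (derivable_pt_lim_minus (fun x => x) (fun _ => c));
        [apply derivable_pt_lim_id | apply derivable_pt_lim_const].
    - apply (derivable_pt_lim_scal Phi). apply HPhi. }
  destruct (MVT_cor3 _ _ a (a + h) ltac:(lra) (fun x _ _ => Hd x)) as [z [Hz1 [Hz2 Hz]]].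
  assert (Hpos : 0 <= C * phi (z - c) - D * phi z).
  { assert (E : C * phi (z - c) = exp (Rabs c * h + c * z) * phi z).
    { unfold C, phi, Rdiv. rewrite <- !Rmult_assoc, <- !exp_plus. f_equal. f_equal. field. }
    rewrite E. unfold D.
    assert (exp (c * a) <= exp (Rabs c * h + c * z)).
    { apply exp_le_compat. assert (- c * (z - a) <= Rabs c * h); [|lra].
      apply Rle_trans with (Rabs c * (z - a)).
      - apply Rmult_le_compat_r; [lra|]. rewrite <- Rabs_Ropp. apply Rle_abs.
      - apply Rmult_le_compat_l; [apply Rabs_pos|lra]. }
    assert (0 < phi z).
    { apply Rdiv_lt_0_compat; [apply exp_pos|]. apply sqrt_lt_R0. pose proof PI_RGT_0. lra. }
    nra. }
  replace (a + h - c) with ((a + h) - c) by ring. nra.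
Qed.

Section Grid.
Variables (lo h : R) (n : nat).
Hypothesis Hh : 0 < h.

Definition grid (m : nat) : R := lo + INR m * h.

Lemma grid_S m : grid (S m) = grid m + h.
Proof. unfold grid. rewrite S_INR. ring. Qed.

Definition cell_bound (c : R) (m : nat) : R := exp (c * grid m + Rabs c * h).

Lemma grid_locate m x : grid 0 < x <= grid m -> exists k, (k < m)%nat /\ grid k < x <= grid (S k).
Proof.
  induction m; intros H; [lra|].
  destruct (Rlt_dec (grid m) x) as [h1|h1]; [exists m; split; [lia|lra]|].
  destruct IHm as [k [Hk Hk']]; [lra|]. exists k; split; auto.
Qed.

Lemma cell_bound_ge c m x : grid m < x <= grid (S m) -> exp (c * x) <= cell_bound c m.
Proof.
  rewrite grid_S. intros H. apply exp_le_compat.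
  assert (c * (x - grid m) <= Rabs c * h); [|lra].
  apply Rle_trans with (Rabs c * (x - grid m)).
  - apply Rmult_le_compat_r; [lra|apply Rle_abs].
  - apply Rmult_le_compat_l; [apply Rabs_pos|lra].
Qed.

(** One [Rabs c * h] comes from the majorant [cell_bound], the other from [exp_moment_cell]; the
    telescoped sum is at most 1. *)
Lemma exp_moment_grid c :
  rsum n (fun m => cell_bound c m * (Phi (grid (S m)) - Phi (grid m))) <= exp (c ^ 2 / 2 + 2 * Rabs c * h).
Proof.
  apply Rle_trans with (rsum n (fun m => exp (c ^ 2 / 2 + 2 * Rabs c * h) *
     (Phi (grid (S m) - c) - Phi (grid m - c)))).
  - apply rsum_le; intros m _. unfold cell_bound. rewrite grid_S.
    pose proof (exp_moment_cell c (grid m) h Hh).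
    replace (c ^ 2 / 2 + 2 * Rabs c * h) with (Rabs c * h + (Rabs c * h + c ^ 2 / 2)) by ring.
    rewrite (Rplus_comm (c * grid m)), !exp_plus, !Rmult_assoc. rewrite exp_plus, Rmult_assoc in H.
    apply Rmult_le_compat_l; [left; apply exp_pos|]. lra.
  - rewrite rsum_scal_l.
    assert (E : rsum n (fun m => Phi (grid (S m) - c) - Phi (grid m - c)) = Phi (grid n - c) - Phi (grid 0 - c)).
    { clear. induction n; simpl; [ring|]. rewrite IHn0. ring. }
    rewrite E. pose proof (Phi_bounds (grid n - c)). pose proof (Phi_bounds (grid 0 - c)).
    rewrite <- (Rmult_1_r (exp _)) at 2. apply Rmult_le_compat_l; [left; apply exp_pos | lra].
Qed.

(* Step-function majorant of [exp (sum_k c_(s_k) X_(s_k,k))], as a list of coefficients and boxes. *)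
Fixpoint path_simple (c : nat -> R) (s : list nat) (k : nat) : list (R * list ((nat * nat) * (R * R))) :=
  match s with
  | [] => [(1, [])]
  | a :: r => flat_map (fun m => map (fun p =>
        (cell_bound (c a) m * fst p, ((a, k), (grid m, grid (S m))) :: snd p))
        (path_simple c r (S k))) (seq 0 n)
  end.

Fixpoint path_linear (c : nat -> R) (s : list nat) (k : nat) (w : Omega) : R :=
  match s with
  | [] => 0
  | a :: r => c a * X a k w + path_linear c r (S k) w
  end.

(** Times increase along a path, so the lower bound [k] on the time indices is the invariant behind
    [NoDup], and [NoDup] is what [Pr_box] needs. *)
Lemma path_simple_spec c s k p : Forall (fun a => (a < N)%nat) s -> (1 <= k)%nat ->
  In p (path_simple c s k) ->
  0 <= fst p /\
  Forall (fun q => (valid (fst q) /\ fst (snd q) <= snd (snd q)) /\ (k <= snd (fst q))%nat) (snd p) /\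
  NoDup (map fst (snd p)).
Proof.
  revert k p. induction s as [|a r IH]; intros k p Hs Hk Hp; simpl in Hp.
  - destruct Hp as [<-|[]]. simpl. repeat split; [lra | constructor | constructor].
  - inversion Hs; subst. apply in_flat_map in Hp as [m [_ Hp]].
    apply in_map_iff in Hp as [q [<- Hq]].
    destruct (IH (S k) q) as [h1 [h2 h3]]; auto. simpl. repeat split.
    + apply Rmult_le_pos; auto. left; apply exp_pos.
    + constructor.
      * simpl. rewrite grid_S. repeat split; simpl; auto; lra.
      * eapply Forall_impl; [|apply h2]. simpl. intros; intuition lia.
    + constructor; auto. intros Hin. apply in_map_iff in Hin as [q' [E Hq']].
      rewrite Forall_forall in h2. specialize (h2 q' Hq'). rewrite E in h2. simpl in h2. lia.
Qed.

Lemma path_simple_ge c s k w :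
  (forall a l, In a s -> (k <= l < k + length s)%nat -> grid 0 < X a l w <= grid n) ->
  exp (path_linear c s k w) <=
  simple_val Omega (map (fun p => (fst p, in_box (snd p))) (path_simple c s k)) w.
Proof.
  revert k. induction s as [|a r IH]; intros k H; unfold simple_val; simpl.
  - unfold lsum; simpl. rewrite exp_0. destruct excluded_middle_informative as [h'|h']; [lra|].
    exfalso. apply h'. constructor.
  - specialize (IH (S k)). rewrite exp_plus, lsum_map, lsum_flat_map.
    destruct (grid_locate n (X a k w)) as [m [Hm Hx]].
    { apply H; simpl; [auto|lia]. }
    refine (Rle_trans _ _ _ _ (lsum_ge_term _ _ (seq 0 n) m _ _)).
    + cbv beta. rewrite lsum_map. simpl.
      rewrite (lsum_ext _ _ (fun p => cell_bound (c a) m *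
        (fst p * if excluded_middle_informative (in_box (snd p) w) then 1 else 0))).
      * rewrite lsum_scal. apply Rmult_le_compat; try (left; apply exp_pos).
        -- apply cell_bound_ge; auto.
        -- unfold simple_val in IH. rewrite lsum_map in IH. apply IH.
           intros b l Hb Hl. apply H; simpl; [auto|lia].
      * intros p _. rewrite Rmult_assoc. do 2 f_equal.
        destruct excluded_middle_informative as [h1|h1];
          destruct excluded_middle_informative as [h2|h2]; auto; exfalso.
        -- apply h2. inversion h1; auto.
        -- apply h1. constructor; auto. unfold in_cell; simpl. lra.
    + intros m' _. rewrite lsum_map. apply lsum_nonneg. intros p Hp. simpl.
      assert (0 <= fst p).
      { clear - Hp. revert Hp. generalize (S k). revert p. induction r as [|b r IH]; simpl; intros p j Hp.
        - destruct Hp as [<-|[]]. simpl; lra.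
        - apply in_flat_map in Hp as [m [_ Hp]]. apply in_map_iff in Hp as [q [<- Hq]].
          simpl. apply Rmult_le_pos; [left; apply exp_pos | eapply IH; eauto]. }
      apply Rmult_le_pos; [apply Rmult_le_pos; auto; left; apply exp_pos|].
      destruct excluded_middle_informative; lra.
    + apply in_seq. lia.
Qed.

Lemma path_simple_integral c s k : Forall (fun a => (a < N)%nat) s -> (1 <= k)%nat ->
  lsum (fun p => fst p * box_weight (snd p)) (path_simple c s k) <=
  exp (lsum (fun a => c a ^ 2 / 2 + 2 * Rabs (c a) * h) s).
Proof.
  revert k. induction s as [|a r IH]; intros k Hs Hk.
  - unfold lsum, box_weight; simpl. rewrite exp_0. lra.
  - inversion Hs; subst. rewrite lsum_cons, exp_plus. simpl. rewrite lsum_flat_map, lsum_seq.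
    rewrite (rsum_ext n _ (fun m => (cell_bound (c a) m * (Phi (grid (S m)) - Phi (grid m))) *
       lsum (fun p => fst p * box_weight (snd p)) (path_simple c r (S k)))).
    + rewrite rsum_scal_r.
      assert (0 <= lsum (fun p => fst p * box_weight (snd p)) (path_simple c r (S k))).
      { apply lsum_nonneg. intros p Hp. destruct (path_simple_spec c r (S k) p) as [h1 [h2 h3]]; auto.
        assert (Hv : Forall (fun p => valid (fst p) /\ fst (snd p) <= snd (snd p)) (snd p)).
        { eapply Forall_impl; [|apply h2]. simpl; tauto. }
        apply Rmult_le_pos; auto. rewrite <- Pr_box; auto.
        apply (Pr_nonneg _ _ _ HPr), F_box. eapply Forall_impl; [|apply Hv]. simpl; tauto. }
      eapply Rle_trans; [apply Rmult_le_compat_r; [auto|apply exp_moment_grid]|].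
      apply Rmult_le_compat_l; [left; apply exp_pos|]. apply IH; auto.
    + intros m _. rewrite lsum_map, <- lsum_scal. apply lsum_ext; intros p _.
      unfold box_weight. simpl. ring.
Qed.
End Grid.

(** A single grid serves all coordinates because they share the law [Phi]: the upper end is found
    for one of them and transferred through [Phi]. *)
Lemma grid_exists h eta : 0 < h -> 0 < eta -> exists lo n, forall v, valid v ->
  Pr (fun w => X (fst v) (snd v) w <= grid lo h 0 \/ ~ X (fst v) (snd v) w <= grid lo h n) <= eta.
Proof.
  intros Hh He. destruct HPhi as [_ HM]. destruct (HM (eta / 2) ltac:(lra)) as [lo Hlo].
  assert (Hv0 : valid (O, 1%nat)) by (split; simpl; lia).
  destruct (Pr_upper_tail Omega F Pr HPr (X O 1%nat) (eta / 2) (fun a => F_le (O, 1%nat) a Hv0) ltac:(lra)) as [M HMM].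
  destruct (INR_unbounded ((M - lo) / h)) as [n Hn].
  exists lo, n. intros v Hv.
  eapply Rle_trans; [apply (Pr_or_le _ _ _ HPr (fun w => X (fst v) (snd v) w <= grid lo h 0))|].
  - apply F_le; auto.
  - apply (F_not _ _ _ HPr (fun w => X (fst v) (snd v) w <= grid lo h n)), F_le; auto.
  - rewrite (Pr_not _ _ _ HPr (fun w => X (fst v) (snd v) w <= grid lo h n)) by (apply F_le; auto).
    rewrite !Pr_le_Phi by auto.
    specialize (Hlo (grid lo h 0)). unfold grid at 1 in Hlo. simpl in Hlo.
    specialize (Hlo ltac:(lra)). apply Rabs_def2 in Hlo.
    rewrite (Pr_not _ _ _ HPr (fun w => X O 1%nat w <= M)) in HMM by (apply (F_le (O, 1%nat)); auto).
    assert (Hmono : Pr (fun w => X O 1%nat w <= M) <= Pr (fun w => X O 1%nat w <= grid lo h n)).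
    { apply (Pr_mono _ _ _ HPr); [apply (F_le (O, 1%nat)); auto | apply (F_le (O, 1%nat)); auto|].
      intros w hw. eapply Rle_trans; [apply hw|]. unfold grid.
      assert ((M - lo) / h * h < INR n * h) by (apply Rmult_lt_compat_r; auto).
      replace ((M - lo) / h * h) with (M - lo) in H by (field; lra). lra. }
    change (fun w => X O 1%nat w <= grid lo h n) with (fun w => X (fst (O, 1%nat)) (snd (O, 1%nat)) w <= grid lo h n) in Hmono.
    rewrite (Pr_le_Phi (O, 1%nat) (grid lo h n) Hv0) in Hmono. lra.
Qed.

Lemma path_exponent_linear sigma beta w s k :
  sigma * path_exponent beta (fun i k => X i k w) s k =
  path_linear (fun a => sigma * beta a) s k w - lsum (fun a => sigma * beta a ^ 2 / 2) s.
Proof.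
  revert k. induction s as [|a r IH]; intros k; simpl path_exponent; simpl path_linear.
  - unfold lsum; simpl; ring.
  - rewrite lsum_cons, Rmult_plus_distr_l, IH. field.
Qed.

(** Markov's inequality for the sum of the powers of order [sigma], applied to a simple majorant
    valid only while all observations stay on the grid. [/ K] pays for Markov, [eta] for leaving the
    grid, and [exp (2 * b * h * INR T)] for the mesh. *)
Lemma likelihood_power_tail P pi beta b sigma T h eta K :
  (forall i j, (i < N)%nat -> (j < N)%nat -> 0 <= P i j) ->
  (forall i, (i < N)%nat -> 0 < pi i <= 1) ->
  0 <= sigma <= 1 -> (forall i, (i < N)%nat -> Rabs (beta i) <= b) ->
  0 < h -> 0 < eta -> 0 < K ->
  let W := lsum (path_prob (fun _ => 1) (tilt P beta sigma)) (paths N T) in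
  0 < W ->
  exists bad, F bad /\ Pr bad <= / K + eta /\ forall w, ~ bad w ->
    lsum (fun s => if Rlt_dec 0 (path_prob pi P s)
                   then exp (sigma * (ln (path_prob pi P s) + path_exponent beta (fun i k => X i k w) s 1))
                   else 0) (paths N T) <= K * (exp (2 * b * h * INR T) * W).
Proof.
  intros HP Hpi Hs Hb Hh He HK W HW.
  set (idx := list_prod (seq 0 N) (seq 1 T)).
  set (eta' := eta / (INR (length idx) + 1)).
  assert (He' : 0 < eta') by (apply Rdiv_lt_0_compat; [auto|pose proof (pos_INR (length idx)); lra]).
  destruct (grid_exists h eta' Hh He') as [lo [n Hgrid]].
  set (tail := fun w => Exists (fun v => X (fst v) (snd v) w <= grid lo h 0 \/ ~ X (fst v) (snd v) w <= grid lo h n) idx).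
  assert (Hidx : forall v, In v idx -> valid v).
  { intros [i k] Hv. apply in_prod_iff in Hv as [h1 h2]. apply in_seq in h1. apply in_seq in h2.
    split; simpl; lia. }
  assert (HFv : forall v, In v idx -> F (fun w => X (fst v) (snd v) w <= grid lo h 0 \/ ~ X (fst v) (snd v) w <= grid lo h n)).
  { intros v Hv. apply (F_or _ _ _ HPr); [apply F_le; auto|].
    apply (F_not _ _ _ HPr (fun w => X (fst v) (snd v) w <= grid lo h n)), F_le; auto. }
  assert (HFt : F tail) by (apply (F_Exists _ _ _ HPr _ (fun v w => X (fst v) (snd v) w <= grid lo h 0 \/ ~ X (fst v) (snd v) w <= grid lo h n)); auto).
  assert (HPt : Pr tail <= eta).
  { eapply Rle_trans; [apply (Pr_Exists_le _ _ _ HPr _ (fun v w => X (fst v) (snd v) w <= grid lo h 0 \/ ~ X (fst v) (snd v) w <= grid lo h n) idx eta')|]; auto.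
    unfold eta'. pose proof (pos_INR (length idx)).
    apply Rle_trans with ((INR (length idx) + 1) * (eta / (INR (length idx) + 1))); [|right; field; lra].
    apply Rmult_le_compat_r; [left; apply He' | lra]. }
  (* The deterministic part of the power of order [sigma]; the random part [exp (sum sigma beta X)]
     is majorized by [path_simple]. *)
  set (coef := fun s => exp (sigma * ln (path_prob pi P s) - lsum (fun a => sigma * beta a ^ 2 / 2) s)).
  set (U := flat_map (fun s => if Rlt_dec 0 (path_prob pi P s) then
      map (fun p => (coef s * fst p, in_box (snd p))) (path_simple lo h n (fun a => sigma * beta a) s 1)
      else []) (paths N T)).
  assert (HU : forall p, In p U -> 0 <= fst p /\ F (snd p)).
  { intros p Hp. apply in_flat_map in Hp as [s [Hsp Hp]]. apply paths_spec in Hsp as [_ Hsp].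
    destruct Rlt_dec as [_|_]; [|destruct Hp].
    apply in_map_iff in Hp as [q [<- Hq]].
    destruct (path_simple_spec lo h n Hh _ s 1%nat q Hsp (le_n _) Hq) as [h1 [h2 _]]. simpl. split.
    - apply Rmult_le_pos; auto. left; apply exp_pos.
    - apply F_box. eapply Forall_impl; [|apply h2]. simpl; tauto. }
  assert (HI : lsum (fun p => fst p * Pr (snd p)) U <= exp (2 * b * h * INR T) * W).
  { unfold U, W. rewrite lsum_flat_map, <- lsum_scal. apply lsum_le; intros s Hsp.
    apply paths_spec in Hsp as [Hlen Hsp]. destruct Rlt_dec as [hp|hp].
    - rewrite lsum_map. simpl.
      rewrite (lsum_ext _ _ (fun p => coef s * (fst p * box_weight (snd p)))).
      + rewrite lsum_scal. eapply Rle_trans.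
        * apply Rmult_le_compat_l; [left; apply exp_pos|]. apply path_simple_integral; auto.
        * pose proof (path_prob_tilt N P pi beta sigma s HP Hpi Hs Hsp hp) as Ht.
          eapply Rle_trans; [|apply Rmult_le_compat_l; [left; apply exp_pos | apply Ht]].
          unfold coef. rewrite <- !exp_plus. apply exp_le_compat.
          (* Split [(sigma beta)^2 / 2] as [(sigma^2 - sigma) beta^2 / 2 + sigma beta^2 / 2]: the
             first part is the exponent in [tilt], the second cancels against [coef]. *)
          assert (E : forall r, Forall (fun a => (a < N)%nat) r ->
            lsum (fun a => (sigma * beta a) ^ 2 / 2 + 2 * Rabs (sigma * beta a) * h) r <=
            lsum (fun a => (sigma ^ 2 - sigma) * beta a ^ 2 / 2) r + lsum (fun a => sigma * beta a ^ 2 / 2) r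
            + 2 * b * h * INR (length r)).
          { induction r as [|a r IH]; intros Hr; [unfold lsum; simpl; lra|].
            inversion Hr; subst. specialize (IH ltac:(auto)). simpl length. rewrite !lsum_cons, S_INR.
            assert (Rabs (sigma * beta a) * h <= b * h).
            { apply Rmult_le_compat_r; [lra|]. rewrite Rabs_mult, (Rabs_right sigma) by lra.
              specialize (Hb a ltac:(auto)). pose proof (Rabs_pos (beta a)).
              apply Rle_trans with (1 * Rabs (beta a)); [apply Rmult_le_compat_r; lra | lra]. }
            replace ((sigma * beta a) ^ 2 / 2) with ((sigma ^ 2 - sigma) * beta a ^ 2 / 2 + sigma * beta a ^ 2 / 2) by field.
            lra. }
          specialize (E s Hsp). rewrite Hlen in E. lra.
      + intros p Hp. destruct (path_simple_spec lo h n Hh _ s 1%nat p Hsp (le_n _) Hp) as [h1 [h2 h3]].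
        rewrite Pr_box; auto; [ring|]. eapply Forall_impl; [|apply h2]. simpl; tauto.
    - unfold lsum; simpl. apply Rmult_le_pos; [left; apply exp_pos|].
      assert (Hc : forall a r, 0 <= chain_prob (tilt P beta sigma) a r).
      { intros a r. revert a. induction r as [|c r IH]; intros a; simpl; [lra|].
        apply Rmult_le_pos; auto. unfold tilt. destruct Rlt_dec; [left; apply exp_pos|lra]. }
      destruct s as [|a r]; simpl; [lra|]. rewrite Rmult_1_l. auto. }
  assert (HE : 0 < exp (2 * b * h * INR T) * W) by (apply Rmult_lt_0_compat; auto using exp_pos).
  set (E0 := exp (2 * b * h * INR T) * W) in *.
  assert (HKE : 0 < K * E0) by (apply Rmult_lt_0_compat; auto).
  exists (fun w => K * E0 <= simple_val Omega U w \/ tail w).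
  assert (HFU : F (fun w => K * E0 <= simple_val Omega U w)) by (apply (F_simple_ge _ _ _ HPr); apply HU).
  split; [apply (F_or _ _ _ HPr); auto|]. split.
  - eapply Rle_trans; [apply (Pr_or_le _ _ _ HPr); auto|]. apply Rplus_le_compat; auto.
    eapply Rle_trans; [apply (simple_markov _ _ _ HPr); auto|].
    apply Rle_trans with (E0 / (K * E0)); [|right; field; lra].
    apply Rmult_le_compat_r; auto. left; apply Rinv_0_lt_compat; auto.
  - intros w Hw. apply not_or_and in Hw as [Hw1 Hw2]. apply Rnot_le_lt in Hw1.
    eapply Rle_trans; [|left; apply Hw1].
    unfold simple_val, U. rewrite lsum_flat_map. apply lsum_le; intros s Hsp.
    apply paths_spec in Hsp as [Hlen Hsp]. destruct Rlt_dec as [hp|hp].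
    + rewrite Rmult_plus_distr_l, path_exponent_linear, lsum_map. cbn [fst snd].
      rewrite (lsum_ext _ _ (fun p => coef s * (fst p *
         if excluded_middle_informative (in_box (snd p) w) then 1 else 0)))
        by (intros; apply Rmult_assoc).
      rewrite lsum_scal.
      pose proof (path_simple_ge lo h n (fun a => sigma * beta a) s 1%nat w) as Hge.
      unfold simple_val in Hge. rewrite lsum_map in Hge.
      eapply Rle_trans; [|apply Rmult_le_compat_l; [left; apply exp_pos | apply Hge]].
      * unfold coef. rewrite <- exp_plus. right; f_equal; ring.
      * intros a l Ha Hl.
        assert (Hin : In (a, l) idx).
        { apply in_prod; apply in_seq; [|lia]. rewrite Forall_forall in Hsp. specialize (Hsp a Ha). lia. }
        destruct (classic (grid lo h 0 < X a l w <= grid lo h n)) as [|Hno]; auto.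
        exfalso. apply Hw2. unfold tail. rewrite Exists_exists. exists (a, l). split; auto. simpl.
        destruct (Rle_dec (X a l w) (grid lo h 0)); auto. right. lra.
    + unfold lsum; simpl; lra.
Qed.
End Gaussian.

(** * The error exponent *)

(** Each summand [a] satisfies [a^sigma <= V], hence [a = a^sigma a^(1 - sigma) <= a^sigma V^(1 /
    sigma - 1)]; now sum. *)
Lemma Lt_le_of_power N pi P beta t x sigma V : 0 < sigma <= 1 -> 0 < V ->
  lsum (fun s => if Rlt_dec 0 (path_prob pi P s)
                 then exp (sigma * (ln (path_prob pi P s) + path_exponent beta x s 1))
                 else 0) (paths N t) <= V ->
  Lt N pi P beta t x <= exp (ln V / sigma).
Proof.
  intros Hs HV H.
  set (f := fun s => if Rlt_dec 0 (path_prob pi P s)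
                 then exp (sigma * (ln (path_prob pi P s) + path_exponent beta x s 1)) else 0) in H.
  assert (Hf : forall s, 0 <= f s) by (intros s; unfold f; destruct Rlt_dec; [left; apply exp_pos|lra]).
  apply Rle_trans with (lsum (fun s => exp (ln V / sigma) * / V * f s) (paths N t)).
  - apply lsum_le. intros s Hin.
    pose proof (lsum_ge_term _ f _ s (fun a _ => Hf a) Hin) as Hle.
    unfold f in *. destruct Rlt_dec as [hp|hp]; [|lra].
    set (e := path_exponent beta x s 1) in *. set (p := path_prob pi P s) in *.
    rewrite <- (exp_ln p) at 1 by auto. rewrite <- exp_plus.
    rewrite <- (exp_ln (/ V)), ln_Rinv, <- !exp_plus by (auto using Rinv_0_lt_compat).
    apply exp_le_compat.
    assert (Hle' : sigma * (ln p + e) <= ln V).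
    { rewrite <- (ln_exp (sigma * _)). apply ln_le_compat; [apply exp_pos|]. lra. }
    set (y := ln p + e) in *. set (v := ln V) in *.
    assert (E : v / sigma = v + (1 - sigma) * (v / sigma)) by (field; lra).
    rewrite E. assert (y <= v / sigma).
    { apply Rmult_le_reg_l with sigma; [lra|]. replace (sigma * (v / sigma)) with v by (field; lra). auto. }
    nra.
  - rewrite lsum_scal. rewrite <- (Rmult_1_r (exp _)) at 2. rewrite Rmult_assoc.
    apply Rmult_le_compat_l; [left; apply exp_pos|].
    apply Rmult_le_reg_l with V; auto. rewrite <- Rmult_assoc, Rinv_r by lra. lra.
Qed.

(** Makes monotonicity of [ln] applicable to the likelihood ratio. The path probabilities sum to 1,
    so some path has positive weight. *)
Lemma Lt_pos N pi P beta t x : row_stochastic N P -> stationary N P pi ->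
  0 < Lt N pi P beta (S t) x.
Proof.
  intros [HP0 HP1] [Hpi [Hpi1 _]].
  set (f := fun s => if Rlt_dec 0 (path_prob pi P s)
                     then path_prob pi P s * exp (path_exponent beta x s 1) else 0).
  change (0 < lsum f (paths N (S t))).
  assert (Hsum : lsum (path_prob pi P) (paths N (S t)) = 1).
  { rewrite paths_sum, <- Hpi1. apply rsum_ext; intros i Hi.
    rewrite mpow_row_sum by auto. ring. }
  destruct (classic (exists s, In s (paths N (S t)) /\ 0 < path_prob pi P s)) as [[s [Hs Hp]]|Hno].
  - apply Rlt_le_trans with (f s).
    + unfold f. destruct Rlt_dec; [|lra]. apply Rmult_lt_0_compat; auto using exp_pos.
    + apply lsum_ge_term; auto. intros a _. unfold f. destruct Rlt_dec; [|lra].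
      left. apply Rmult_lt_0_compat; auto using exp_pos.
  - exfalso. assert (lsum (path_prob pi P) (paths N (S t)) <= lsum (fun _ => 0 * 0) (paths N (S t))).
    { apply lsum_le. intros s Hs. apply Rnot_lt_le. intros Hp. apply Hno. exists s. split; auto. lra. }
    rewrite lsum_scal in H. lra.
Qed.

(* Open walks are closed up by [r0] further steps, at a cost independent of their length. *)
Lemma tilt_paths_le N P beta kappa r0 sigma t : row_stochastic N P ->
  (forall i j, (i < N)%nat -> (j < N)%nat -> Rabs (ln (P i j)) + beta i ^ 2 <= kappa) ->
  (0 < N)%nat ->
  (forall n i j, (r0 <= n)%nat -> (i < N)%nat -> (j < N)%nat -> 0 < mpow N P n i j) ->
  0 <= sigma <= 1 ->
  lsum (path_prob (fun _ => 1) (tilt P beta sigma)) (paths N (S t)) <=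
  exp (kappa * INR r0) * trpow N (tilt P beta sigma) (t + r0).
Proof.
  intros HP Hk HN Hprim Hs. rewrite paths_sum, trpow_add, <- rsum2_scal_l.
  pose proof (kappa_nonneg N P beta kappa HN Hk) as Hk0.
  apply rsum_le; intros i Hi. rewrite Rmult_1_l. apply rsum_le; intros j Hj.
  assert (H1 : 1 <= exp (kappa * INR r0) * mpow N (tilt P beta sigma) r0 j i).
  { pose proof (tilt_mpow_ge N P beta kappa HP Hk sigma r0 j i Hs Hj Hi).
    pose proof (tilt_0_mpow_ge_1 N P beta r0 HP Hprim r0 j i (le_n _) Hj Hi).
    apply Rle_trans with (exp (kappa * INR r0) * exp (- (kappa * sigma * INR r0))).
    - rewrite <- exp_plus, <- exp_0 at 1. apply exp_le_compat.
      pose proof (pos_INR r0). assert (kappa * sigma <= kappa * 1) by (apply Rmult_le_compat_l; lra).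
      nra.
    - apply Rmult_le_compat_l; [left; apply exp_pos|].
      eapply Rle_trans; [|apply H]. rewrite <- Rmult_1_r at 1.
      apply Rmult_le_compat_l; auto. left; apply exp_pos. }
  pose proof (mpow_nonneg N (tilt P beta sigma) t (tilt_nonneg N P beta sigma) i j Hi Hj).
  rewrite <- (Rmult_1_r (mpow N _ t i j)) at 1.
  replace (exp (kappa * INR r0) * (mpow N (tilt P beta sigma) t i j * mpow N (tilt P beta sigma) r0 j i))
    with (mpow N (tilt P beta sigma) t i j * (exp (kappa * INR r0) * mpow N (tilt P beta sigma) r0 j i)) by ring.
  apply Rmult_le_compat_l; auto.
Qed.

(** Here [Z] is the logarithm of a trace at length [t], [L] that of the likelihood ratio at time
    [T]. The bound [Z <= t * lnN] permits normalizing by [T] instead of [t]. The three [delta] pay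
    for the gap in [dual_bound], the costs that do not grow with [T], and the mesh term [c]. *)
Lemma objective_vs_exponent lnN Z t T r s s0 L obj lnK kr c delta :
  0 <= lnN -> 0 < T -> T <= t <= T + r -> 0 < s0 <= s -> 0 < delta ->
  Z <= t * lnN -> L <= (lnK + c * T + kr + Z) / s -> obj <= (lnN - Z) / (t * s) + delta ->
  lnK + kr + (1 + r) * lnN <= T * delta * s0 -> c <= delta * s0 ->
  obj <= - (/ T) * L + 3 * delta.
Proof.
  intros HlN HT Ht Hs Hd HZ HL Ho Hk Hc.
  assert (H1 : s * L <= lnK + c * T + kr + Z).
  { replace (lnK + c * T + kr + Z) with (s * ((lnK + c * T + kr + Z) / s)) by (field; lra).
    apply Rmult_le_compat_l; lra. }
  assert (H2 : s * T * (obj - delta) <= (1 + r) * lnN - Z).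
  { apply Rle_trans with (s * T * ((lnN - Z) / (t * s))).
    - apply Rmult_le_compat_l; [nra|lra].
    - replace (s * T * ((lnN - Z) / (t * s))) with ((T * lnN + (t - T) * Z - t * Z) * / t) by (field; lra).
      replace ((1 + r) * lnN - Z) with ((t * (1 + r) * lnN - t * Z) * / t) by (field; lra).
      apply Rmult_le_compat_r; [left; apply Rinv_0_lt_compat; lra|].
      assert ((t - T) * Z <= (t - T) * (t * lnN)) by (apply Rmult_le_compat_l; lra).
      assert ((t - T) * (t * lnN) <= r * (t * lnN)) by (apply Rmult_le_compat_r; nra).
      assert (T * lnN <= t * lnN) by (apply Rmult_le_compat_r; lra).
      lra. }
  assert (H3 : c * T <= delta * s0 * T) by (apply Rmult_le_compat_r; lra).
  assert (H4 : T * delta * s0 <= T * delta * s) by (apply Rmult_le_compat_l; nra).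
  apply Rmult_le_reg_l with (s * T); [nra|].
  replace (s * T * (- / T * L + 3 * delta)) with (- (s * L) + 3 * (T * delta * s)) by (field; lra).
  lra.
Qed.

Theorem theorem2
  (N : nat) (P : nat -> nat -> R) (pi : nat -> R) (beta : nat -> R)
  (HP : row_stochastic N P) (Hirr : irreducible N P) (Hap : aperiodic N P)
  (Hpi : stationary N P pi)
  (Omega : Type) (F : (Omega -> Prop) -> Prop) (Pr : (Omega -> Prop) -> R)
  (HPr : prob_space Omega F Pr)
  (Phi : R -> R) (HPhi : std_normal_cdf Phi)
  (X : nat -> nat -> Omega -> R) (HX : iid_std_gaussian N Omega F Pr Phi X)
  (zeta : R)
  (Hzeta : exists E : Omega -> Prop, F E /\ Pr E = 1 /\
             forall w, E w ->
               Un_cv (fun n => - (/ INR (S n)) * ln (Lt N pi P beta (S n) (fun i k => X i k w)))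
                     zeta) :
  forall eps, 0 < eps ->
    exists (theta : nat -> nat -> R) (xi : nat -> R),
      feasible N P theta xi /\ objective N P beta theta xi < zeta + eps.
Proof.
  (* Four [delta] are spent: three in [objective_vs_exponent], one on the limit [zeta]. *)
  intros eps Heps. set (delta := eps / 8). assert (Hd : 0 < delta) by (unfold delta; lra).
  assert (HN : (0 < N)%nat).
  { destruct N; [|lia]. destruct Hpi as [_ [H _]]. simpl in H. lra. }
  assert (HN1 : 1 <= INR N) by (apply (le_INR 1); lia).
  assert (HlnN : 0 <= ln (INR N)) by (rewrite <- ln_1; apply ln_le_compat; lra).
  assert (Hpi1 : forall i, (i < N)%nat -> 0 < pi i <= 1).
  { intros i Hi. destruct Hpi as [H0 [H1 _]]. split; auto. rewrite <- H1.
    apply rsum_ge_term; auto. intros; left; auto. }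
  set (kappa := rsum N (fun i => rsum N (fun j => Rabs (ln (P i j)) + beta i ^ 2))).
  assert (Hterm : forall i j, 0 <= Rabs (ln (P i j)) + beta i ^ 2).
  { intros i j. pose proof (Rabs_pos (ln (P i j))). pose proof (pow2_ge_0 (beta i)). lra. }
  assert (Hk : forall i j, (i < N)%nat -> (j < N)%nat -> Rabs (ln (P i j)) + beta i ^ 2 <= kappa).
  { intros i j Hi Hj.
    eapply Rle_trans; [apply (rsum_ge_term N (fun j => Rabs (ln (P i j)) + beta i ^ 2) j); auto|].
    apply (rsum_ge_term N (fun i => rsum N (fun j => Rabs (ln (P i j)) + beta i ^ 2)) i); auto.
    intros; apply rsum_nonneg; auto. }
  pose proof (kappa_nonneg N P beta kappa HN Hk) as Hk0.
  (* Uses [Rabs x <= x ^ 2 + 1]; the summand 1 also keeps [b] positive. *)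
  set (b := kappa + 1).
  assert (Hb : forall i, (i < N)%nat -> Rabs (beta i) <= b).
  { intros i Hi. specialize (Hk i O Hi HN). pose proof (Rabs_pos (ln (P i O))).
    unfold b. unfold Rabs in *. destruct (Rcase_abs (beta i)); nra. }
  destruct (mpow_eventually_pos N P (proj1 HP) Hirr Hap) as [n0 Hn0].
  set (r0 := S n0).
  assert (Hprim : forall n i j, (r0 <= n)%nat -> (i < N)%nat -> (j < N)%nat -> 0 < mpow N P n i j).
  { intros n i j Hn. apply Hn0. unfold r0 in Hn. lia. }
  assert (Hr0 : (1 <= r0)%nat) by (unfold r0; lia). clearbody r0. clear n0 Hn0.
  destruct (dual_bound N P beta kappa r0 HN HP Hk Hr0 Hprim delta Hd) as [s0 [Hs0 Hdual]].
  (* Makes the mesh cost per time step, [2 * b * h], equal to [delta * s0]. *)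
  set (h := delta * s0 / (2 * b)).
  assert (Hh : 0 < h) by (apply Rdiv_lt_0_compat; unfold b; nra).
  (* The costs that do not scale with time sum to at most [(n + 2) * c1], because
     [(n + 3) ln 2 <= 2 (n + 2) ln 2]. Taking [m = (n + 2) * m0] with [m0] above [c1 / (delta * s0)]
     absorbs them. *)
  set (c1 := 2 * ln 2 + kappa * INR r0 + (1 + INR r0) * ln (INR N)).
  assert (Hln2 : 0 < ln 2) by (rewrite <- ln_1; apply ln_increasing; lra).
  assert (Hr0' : 1 <= INR r0) by (apply (le_INR 1); auto).
  assert (Hc1 : 0 < c1) by (unfold c1; nra).
  destruct (INR_unbounded (c1 / (delta * s0))) as [m0 Hm0].
  assert (Hm0' : c1 < INR m0 * (delta * s0)).
  { replace c1 with (c1 / (delta * s0) * (delta * s0)) by (field; nra).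
    apply Rmult_lt_compat_r; [nra|auto]. }
  assert (Hm1 : (1 <= m0)%nat).
  { destruct m0; [simpl in Hm0'; lra|lia]. }
  (* [theta], [xi] and [t] are fixed before the sample point [w], so one good [w] will give a
     deterministic inequality. *)
  assert (Hbad : forall n, exists bad, (F bad /\ Pr bad <= (/ 2) ^ (n + 2)) /\
    exists theta xi t, (n <= t)%nat /\ feasible N P theta xi /\ forall w, ~ bad w ->
      objective N P beta theta xi <=
      - / INR (S t) * ln (Lt N pi P beta (S t) (fun i k => X i k w)) + 3 * delta).
  { intros n. set (m := ((n + 2) * m0)%nat).
    assert (Hm : (n + 2 <= m)%nat) by (unfold m; nia).
    destruct (Hdual m ltac:(lia)) as [s [theta [xi [Hs [Hfeas Hobj]]]]].
    (* A path of [S t] states makes [t] steps; the [r0] closing steps bring the length to the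
       [r0 * m] of [dual_bound]. *)
    set (t := (r0 * (m - 1))%nat).
    assert (Ht : (t + r0 = r0 * m)%nat) by (unfold t; nia).
    assert (HtS : (m <= S t)%nat) by (unfold t; nia).
    set (W := lsum (path_prob (fun _ => 1) (tilt P beta s)) (paths N (S t))).
    set (Z := trpow N (tilt P beta s) (r0 * m)) in *.
    assert (HWZ : W <= exp (kappa * INR r0) * Z).
    { unfold W, Z. rewrite <- Ht. apply tilt_paths_le; auto; lra. }
    assert (HW : 0 < W).
    { unfold W. rewrite paths_sum.
      assert (forall i j, (i < N)%nat -> (j < N)%nat -> 0 < mpow N (tilt P beta s) t i j).
      { intros. apply (tilt_mpow_pos N P beta r0); auto. unfold t. nia. }
      apply (rsum_pos N _ O); auto.
      - intros. rewrite Rmult_1_l. apply rsum_nonneg; intros; left; auto.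
      - rewrite Rmult_1_l. apply (rsum_pos N _ O); auto. intros; left; auto. }
    assert (HZ : 0 < Z) by (pose proof (exp_pos (kappa * INR r0)); nra).
    assert (HZN : ln Z <= INR (r0 * m) * ln (INR N)).
    { rewrite <- ln_pow by lra. apply ln_le_compat; auto. apply trpow_upper.
      - apply tilt_nonneg.
      - nia.
      - intros; apply (tilt_le_1 N P beta kappa); auto; lra. }
    (* [/ K] and [eta] are both [(/ 2) ^ (n + 3)], adding up to [(/ 2) ^ (n + 2)]. *)
    set (K := 2 ^ (n + 3)). assert (HK : 0 < K) by (apply pow_lt; lra).
    destruct (likelihood_power_tail N Omega F Pr Phi X HN HPr HPhi HX P pi beta b s (S t) h
       ((/ 2) ^ (n + 3)) K (proj1 HP) Hpi1 ltac:(lra) Hb Hh ltac:(apply pow_lt; lra) HK HW)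
      as [bad [HFb [HPb Hlik]]].
    exists bad. split; [split; auto|].
    - eapply Rle_trans; [apply HPb|]. unfold K. rewrite <- pow_inv.
      replace (n + 3)%nat with (S (n + 2)) by lia. simpl. lra.
    - exists theta, xi, t. split; [lia|]. split; auto. intros w Hw.
      specialize (Hlik w Hw). fold W in Hlik.
      set (V := K * (exp (2 * b * h * INR (S t)) * W)) in *.
      assert (HV : 0 < V) by (apply Rmult_lt_0_compat; auto; apply Rmult_lt_0_compat; auto using exp_pos).
      apply Lt_le_of_power in Hlik; auto; [|lra].
      apply ln_le_exp in Hlik; [|apply Lt_pos; auto].
      assert (HlnV : ln V <= INR (n + 3) * ln 2 + 2 * b * h * INR (S t) + kappa * INR r0 + ln Z).
      { unfold V, K. rewrite !ln_mult, ln_exp, ln_pow; auto using exp_pos; try lra.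
        - assert (ln W <= kappa * INR r0 + ln Z); [|lra].
          rewrite <- (ln_exp (kappa * INR r0)), <- ln_mult; auto using exp_pos.
          apply ln_le_compat; auto.
        - apply Rmult_lt_0_compat; auto using exp_pos. }
      assert (HT : INR m <= INR (S t)) by (apply le_INR; auto).
      assert (Hmpos : 0 < INR m) by (apply lt_0_INR; lia).
      apply (objective_vs_exponent (ln (INR N)) (ln Z) (INR (r0 * m)) (INR (S t)) (INR r0) s s0 _ _
        (INR (n + 3) * ln 2) (kappa * INR r0) (2 * b * h)); auto; try lra.
      + rewrite <- Ht. rewrite plus_INR, S_INR. lra.
      + eapply Rle_trans; [apply Hlik|]. apply Rmult_le_compat_r; auto.
        left; apply Rinv_0_lt_compat; lra.
      + apply Rle_trans with (INR (n + 2) * c1).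
        * unfold c1. rewrite !plus_INR. replace (INR 3) with 3 by (simpl; ring). replace (INR 2) with 2 by (simpl; ring).
          pose proof (pos_INR n).
          assert (0 <= kappa * INR r0) by nra. assert (0 <= (1 + INR r0) * ln (INR N)) by nra.
          set (u := kappa * INR r0) in *. set (v := (1 + INR r0) * ln (INR N)) in *. nra.
        * apply Rle_trans with (INR m * (delta * s0)).
          -- unfold m. rewrite mult_INR, Rmult_assoc. apply Rmult_le_compat_l; [apply pos_INR|lra].
          -- rewrite (Rmult_assoc (INR (S t))). apply Rmult_le_compat_r; [nra|auto].
      + right. unfold h. field. unfold b. lra. }
  set (bad := fun n => proj1_sig (constructive_indefinite_description _ (Hbad n))).
  assert (Hbad' : forall n, (F (bad n) /\ Pr (bad n) <= (/ 2) ^ (n + 2)) /\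
    exists theta xi t, (n <= t)%nat /\ feasible N P theta xi /\ forall w, ~ bad n w ->
      objective N P beta theta xi <=
      - / INR (S t) * ln (Lt N pi P beta (S t) (fun i k => X i k w)) + 3 * delta).
  { intros n. exact (proj2_sig (constructive_indefinite_description _ (Hbad n))). }
  clearbody bad. clear Hbad.
  destruct Hzeta as [E [HFE [HE Hcv]]].
  (* All bad events together have probability at most [/ 2], so they cannot cover [E]; one sample
     point is enough, and no limsup event is formed. *)
  assert (Hw : exists w, E w /\ forall n, ~ bad n w).
  { apply NNPP. intros Hno.
    assert (Pr E <= Pr (fun w => exists n, bad n w)).
    { apply (Pr_mono _ _ _ HPr); auto.
      - apply (F_ex _ _ _ HPr). intros; apply Hbad'.
      - intros w Hw. apply NNPP. intros Hn. apply Hno. exists w. split; auto. intros n Hn'. apply Hn; eauto. }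
    assert (Pr (fun w => exists n, bad n w) <= / 2) by (apply (Pr_ex_le_half _ _ _ HPr); apply Hbad').
    lra. }
  destruct Hw as [w [HEw Hnbad]].
  (* The threshold of the limit at [w] also serves as the index of the bad event, since the time
     attached to index [n] is at least [n]. *)
  destruct (Hcv w HEw delta Hd) as [n Hn].
  destruct (Hbad' n) as [_ [theta [xi [t [Hnt [Hfeas Hobj]]]]]].
  exists theta, xi. split; auto. specialize (Hobj w (Hnbad n)).
  specialize (Hn t Hnt). unfold Rdist in Hn. apply Rabs_def2 in Hn. unfold delta in *. lra.
Qed.
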